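(* The unbounded operator $A:B^0\to B^0$ given by $Au=-\Delta u$ with domain $D(A)=\{u\in B^0:\ \Delta u\in B^0\}$ is sectorial of angle $\pi/2$.
   Context: Functions are complex valued on $\mathbb R^n$; $\hat f(\xi)=\int_{\mathbb R^n}e^{-ix\cdot\xi}f(x)\,dx$ is the Fourier transform (extended to tempered distributions); $C_b^0$ is the space of bounded continuous functions on $\mathbb R^n$. $B^0=\{f\in C_b^0:\ \hat f\in L^1(\mathbb R^n)\}$ with norm $\|f\|_{B^0}=\|\hat f\|_{L^1}$ (a Banach space). $\Delta u$ is taken in the sense of distributions. The resolvent set $\rho(A)$ is the set of $z\in\mathbb C$ such that $z-A:D(A)\to B^0$ is bijective with bounded inverse on $B^0$, and $\sigma(A)=\mathbb C\setminus\rho(A)$. For $\omega\in(0,\pi)$ let $S_\omega=\{z\in\mathbb C\setminus\{0\}:\ |\arg z|<\omega\}$. An operator $\mathbf A$ on a Banach space $E$ is called sectorial of angle $\omega$ if $\sigma(\mathbf A)\subset\overline{S}_\omega$ and $\sup_{\lambda\in\mathbb C\setminus\overline S_\omega}\|\lambda(\lambda-\mathbf A)^{-1}\|_{\mathscr B(E)}<\infty$, where $\mathscr B(E)$ is the space of bounded linear operators on $E$ with the operator norm. *)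

(* Defs.v *)
From HB Require Import structures.
From mathcomp Require Import all_boot all_order all_algebra.
From mathcomp Require Import complex.
From mathcomp Require Import all_classical all_reals all_analysis.

Set Implicit Arguments.
Unset Strict Implicit.
Unset Printing Implicit Defensive.

Import Order.TTheory GRing.Theory Num.Theory.
Import numFieldNormedType.Exports.

Local Open Scope classical_set_scope.
Local Open Scope ring_scope.

(* ['rV[T]_n] carries the product sigma-algebra; for [T = R] this is the Borel
  sigma-algebra of R^n. *)

Definition measure_row_display : measure_display -> measure_display.
Proof. exact. Qed.

Section measurable_row.
Context {d : measure_display} {T : measurableType d} (n : nat).

Let coor (i : 'I_n) (x : 'rV[T]_n) : T := x ord0 i.

Let row_set0 : g_sigma_preimage coor set0.
Proof. exact: sigma_algebra0. Qed.

Let row_setC A : g_sigma_preimage coor A -> g_sigma_preimage coor (~` A).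
Proof. exact: sigma_algebraC. Qed.

Let row_bigcup (F : _^nat) : (forall i, g_sigma_preimage coor (F i)) ->
  g_sigma_preimage coor (\bigcup_i (F i)).
Proof. exact: sigma_algebra_bigcup. Qed.

HB.instance Definition _ := @isMeasurable.Build (measure_row_display d)
  'rV[T]_n (g_sigma_preimage coor) row_set0 row_setC row_bigcup.

Lemma measurable_coor (i : 'I_n) :
  measurable_fun [set: 'rV[T]_n] (fun x : 'rV[T]_n => x ord0 i).
Proof.
move=> _ Y mY; rewrite setTI; apply: sub_sigma_algebra => /=.
rewrite -bigcup_seq/=; exists i => /=; first by rewrite mem_index_enum.
by exists Y => //; rewrite setTI.
Qed.

Lemma measurable_fun_row d1 (T1 : measurableType d1) (f : T1 -> 'rV[T]_n) :
  (forall i, measurable_fun [set: T1] (fun t => f t ord0 i)) ->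
  measurable_fun [set: T1] f.
Proof.
move=> mf _ A mA; rewrite setTI.
pose G := [set B : set 'rV[T]_n | measurable (f @^-1` B)].
suff: measurable `<=` G by exact.
apply: smallest_sub.
  split; rewrite /G /=.
  - by rewrite preimage_set0.
  - by move=> B mB; rewrite setTD preimage_setC; exact: measurableC.
  - by move=> F mF; rewrite preimage_bigcup; exact: bigcup_measurable.
move=> B; rewrite -bigcup_seq => -[i _ [C mC <-]]; rewrite /G /= setTI.
by rewrite -[X in measurable X]setTI; exact: mf.
Qed.

End measurable_row.

(* The library has this as an instance on [m1 \x m2], but its later instance for
  products of subprobabilities shadows it. *)
Lemma product_sigma_finite d1 d2 (T1 : measurableType d1)
    (T2 : measurableType d2) (R : realType)
    (m1 : {sigma_finite_measure set T1 -> \bar R})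
    (m2 : {sigma_finite_measure set T2 -> \bar R}) :
  sigma_finite setT (m1 \x m2)%E.
Proof.
have /sigma_finiteP[F [TF ndF Foo]] := sigma_finiteT m1.
have /sigma_finiteP[G [TG ndG Goo]] := sigma_finiteT m2.
exists (fun k => F k `*` G k).
  rewrite -setXTT TF TG predeqE => -[x y]; split.
    move=> [/= [n _ Fnx] [k _ Gky]]; exists (maxn n k) => //; split.
    - by move: x Fnx; exact/subsetPset/ndF/leq_maxl.
    - by move: y Gky; exact/subsetPset/ndG/leq_maxr.
  by move=> [n _ []/= ? ?]; split; exists n.
move=> k; have [? ?] := Foo k; have [? ?] := Goo k.
split; first exact: measurableX.
by rewrite product_measure1E// lte_mul_pinfty// ge0_fin_numE.
Qed.

Section lebesgue_row.
Context {R : realType}.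

Definition row_cons (n : nat) (p : measurableTypeR R * 'rV[R]_n) :
    'rV[R]_n.+1 :=
  row_mx p.1%:M p.2.

Definition row_uncons (n : nat) (x : 'rV[R]_n.+1) :
    measurableTypeR R * 'rV[R]_n :=
  (x ord0 ord0, \row_j x ord0 (lift ord0 j)).

Lemma row_consE n p i : @row_cons n p ord0 i =
  if unlift ord0 i is Some j then p.2 ord0 j else p.1.
Proof.
rewrite /row_cons; case: unliftP => [j ->|->].
  have -> : lift ord0 j = rshift 1 j by apply/val_inj.
  exact: (@row_mxEr _ 1 1 n).
have -> : ord0 = lshift n (ord0 : 'I_1) :> 'I_(1 + n) by apply/val_inj.
by rewrite (@row_mxEl _ 1 1 n) mxE.
Qed.

Lemma row_consK n : cancel (@row_cons n) (@row_uncons n).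
Proof.
move=> [t v]; rewrite /row_uncons row_consE unlift_none; congr pair.
by apply/rowP => j; rewrite mxE row_consE liftK.
Qed.

Lemma measurable_row_cons n : measurable_fun setT (@row_cons n).
Proof.
apply: measurable_fun_row => i; under eq_fun do rewrite row_consE.
case: unliftP => [j _|_]; last exact: measurable_fst.
exact: (measurableT_comp (measurable_coor j) measurable_snd).
Qed.

Lemma measurable_row_uncons n : measurable_fun setT (@row_uncons n).
Proof.
apply/measurable_fun_pairP; split; first exact: measurable_coor.
apply: measurable_fun_row => i /=; under eq_fun do rewrite mxE.
exact: measurable_coor.
Qed.

Section step.
Variables (n : nat) (mu : {sigma_finite_measure set 'rV[R]_n -> \bar R}).

Definition lebesgue_row_step : set 'rV[R]_n.+1 -> \bar R :=
  pushforward (@lebesgue_measure R \x mu)%E (@row_cons n).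

Let step0 : lebesgue_row_step set0 = 0%E.
Proof. by rewrite /lebesgue_row_step /pushforward preimage_set0 measure0. Qed.

Let step_ge0 A : (0 <= lebesgue_row_step A)%E.
Proof. by rewrite /lebesgue_row_step /pushforward measure_ge0. Qed.

Let mstep (A : set 'rV[R]_n.+1) : measurable A ->
  measurable (@row_cons n @^-1` A).
Proof.
by move=> mA; rewrite -[X in measurable X]setTI; exact: measurable_row_cons.
Qed.

Let step_sigma_additive : semi_sigma_additive lebesgue_row_step.
Proof.
move=> F mF tF mUF; rewrite /lebesgue_row_step /pushforward preimage_bigcup.
apply: measure_semi_sigma_additive.
- by move=> k; exact: mstep.
- apply/trivIsetP => /= i j _ _ ij; rewrite -preimage_setI.
  by move/trivIsetP : tF => /(_ _ _ _ _ ij) ->//; rewrite preimage_set0.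
- by rewrite -preimage_bigcup; exact: mstep.
Qed.

HB.instance Definition _ := isMeasure.Build _ _ _ lebesgue_row_step
  step0 step_ge0 step_sigma_additive.

Let step_sigma_finite : sigma_finite setT lebesgue_row_step.
Proof.
have [F TF Ffin] : sigma_finite setT (@lebesgue_measure R \x mu)%E.
  exact: product_sigma_finite.
exists (fun k => @row_uncons n @^-1` F k).
  by rewrite -preimage_bigcup -TF preimage_setT.
move=> k; have [mF Foo] := Ffin k; split.
  by rewrite -[X in measurable X]setTI; exact: measurable_row_uncons.
rewrite /lebesgue_row_step /pushforward -comp_preimage.
by rewrite (_ : _ \o _ = id) //; apply/funext => p /=; rewrite row_consK.
Qed.

HB.instance Definition _ :=
  Measure_isSigmaFinite.Build _ _ _ lebesgue_row_step step_sigma_finite.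

End step.

(* Lebesgue measure on R^n, restricted to the Borel sets, as the n-fold product
  of the one-dimensional one; see [lebesgue_row_box]. *)
Fixpoint lebesgue_row (n : nat) :
    {sigma_finite_measure set 'rV[R]_n -> \bar R} :=
  if n is m.+1 then lebesgue_row_step (lebesgue_row m) else \d_(0 : 'rV[R]_0).

Definition row_box n (A : 'I_n -> set R) : set 'rV[R]_n :=
  [set x | forall i, A i (x ord0 i)].

Lemma measurable_row_box n (A : 'I_n -> set R) :
  (forall i, measurable (A i)) -> measurable (row_box A).
Proof.
move=> mA; rewrite (_ : row_box A = \bigcap_(i in [set: 'I_n])
    [set x : 'rV[R]_n | A i (x ord0 i)]).
  apply: fin_bigcap_measurable => // i _; rewrite -[X in measurable X]setTI.
  exact: measurable_coor.
by apply/seteqP; split => x /= h i *; exact: h.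
Qed.

Lemma lebesgue_row_box n (A : 'I_n -> set R) :
  (forall i, measurable (A i)) ->
  lebesgue_row n (row_box A) = (\prod_(i < n) lebesgue_measure (A i))%E.
Proof.
elim: n A => [|n IH] A mA.
  by rewrite big_ord0 /= diracE mem_set // => -[].
rewrite big_ord_recl -(IH (fun i => A (lift ord0 i))) //.
rewrite -product_measure1E; [|exact: mA|exact: measurable_row_box].
rewrite /= /lebesgue_row_step /pushforward; congr (_ _).
apply/seteqP; split => -[t v] /= h.
  split; first by move: (h ord0); rewrite row_consE unlift_none.
  by move=> i; move: (h (lift ord0 i)); rewrite row_consE liftK.
by move=> i; rewrite row_consE; case: unliftP => [j ->|->];
  [exact: h.2 | exact: h.1].
Qed.

End lebesgue_row.

(* The topology of [R[i]], as for the abstract [numFieldType]s. *)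
HB.instance Definition _ (R : realType) :=
  PseudoPointedMetric.copy R[i] R[i]^o.
HB.instance Definition _ (R : realType) := NormedModule.copy R[i] R[i]^o.

Section complex_functions.
Context {R : realType}.

Definition cabs (z : R[i]) : R := complex.Re `|z|.

(* [expi t] is exp(i t). *)
Definition expi (t : R) : R[i] := (cos t +i* sin t)%C.

Context {n : nat}.
Implicit Types (f g u v phi : 'rV[R]_n -> R[i]) (x xi : 'rV[R]_n).

Definition dot x xi : R := \sum_(i < n) x ord0 i * xi ord0 i.

Definition cintegrable f : Prop :=
  (lebesgue_row n).-integrable setT (EFin \o (fun x => complex.Re (f x))) /\
  (lebesgue_row n).-integrable setT (EFin \o (fun x => complex.Im (f x))).

Definition cintegral f : R[i] :=
  ((\int[lebesgue_row n]_x complex.Re (f x)) +i*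
   (\int[lebesgue_row n]_x complex.Im (f x)))%C.

Definition L1norm f : R := \int[lebesgue_row n]_x cabs (f x).

(* [R[i]] is not a normed module over [R] in the library, so derivatives along
  real directions are taken on the real and imaginary parts. *)
Definition cderivable f x (i : 'I_n) : Prop :=
  derivable (fun y => complex.Re (f y)) x (delta_mx ord0 i) /\
  derivable (fun y => complex.Im (f y)) x (delta_mx ord0 i).

Definition partial (i : 'I_n) f : 'rV[R]_n -> R[i] := fun x =>
  ('D_(delta_mx ord0 i) (fun y => complex.Re (f y)) x +i*
   'D_(delta_mx ord0 i) (fun y => complex.Im (f y)) x)%C.

Definition partials (s : seq 'I_n) f : 'rV[R]_n -> R[i] := foldr partial f s.

Definition smooth f : Prop := forall s : seq 'I_n,
  continuous (partials s f) /\
  forall i x, cderivable (partials s f) x i.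

Definition schwartz f : Prop := smooth f /\
  forall (s : seq 'I_n) (m : 'I_n -> nat), exists M : R, forall x,
    `| \prod_(i < n) x ord0 i ^+ m i | * cabs (partials s f x) <= M.

Definition test_function f : Prop :=
  smooth f /\ compact (closure [set x | f x != 0]).

Definition laplacian f : 'rV[R]_n -> R[i] := fun x =>
  \sum_(i < n) partial i (partial i f) x.

(* Delta u = v in the sense of distributions. *)
Definition distr_laplacian u v : Prop := forall phi, test_function phi ->
  cintegral (fun x => u x * laplacian phi x) =
  cintegral (fun x => v x * phi x).

Definition fourier f : 'rV[R]_n -> R[i] := fun xi =>
  cintegral (fun x => expi (- dot x xi) * f x).

(* The Fourier transform of the tempered distribution [f], defined by
  <f^, phi> = <f, phi^>, is the integrable function [g]. *)
Definition is_fourier f g : Prop := cintegrable g /\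
  forall phi, schwartz phi ->
    cintegral (fun x => f x * fourier phi x) =
    cintegral (fun xi => g xi * phi xi).

Definition bounded_continuous f : Prop :=
  continuous f /\ exists M : R, forall x, cabs (f x) <= M.

Definition B0 : set ('rV[R]_n -> R[i]) :=
  [set f | bounded_continuous f /\ exists g, is_fourier f g].

(* [fhat f] is unique up to a null set, hence [B0norm f] does not depend on the
  choice. *)
Definition fhat f : 'rV[R]_n -> R[i] := xget 0 [set g | is_fourier f g].

Definition B0norm f : R := L1norm (fhat f).

(* A function in [B0] is continuous, hence determined by the distribution it
  defines; so at most one [v] is eligible for a given [u]. *)
Definition dom_neg_laplacian : set ('rV[R]_n -> R[i]) :=
  [set u | B0 u /\ exists v, B0 v /\ distr_laplacian u v].

Definition neg_laplacian u : 'rV[R]_n -> R[i] :=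
  - xget 0 [set v | B0 v /\ distr_laplacian u v].

End complex_functions.

Section sector.
Context {R : realType}.

(* Principal argument, in ]-pi, pi] for [z != 0]. *)
Definition arg (z : R[i]) : R :=
  if 0 <= complex.Im z then acos (complex.Re z / cabs z)
  else - acos (complex.Re z / cabs z).

Definition sector (omega : R) : set R[i] :=
  [set z | z != 0 /\ `|arg z| < omega].

End sector.

(* The normed space is the subspace [E] of [V] with the norm [N]; the operator
  is the restriction of [A : V -> V] to the domain [D]. *)
Section operators.
Context {R : realType} {V : lmodType R[i]}.
Variables (E : set V) (N : V -> R).

Definition op_norm (T : V -> V) : \bar R :=
  ereal_sup [set (N (T f))%:E | f in [set f | E f /\ N f <= 1]].

Variables (D : set V) (A : V -> V).

Definition resolvent (z : R[i]) (f : V) : V :=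
  xget 0 [set u | D u /\ z *: u - A u = f].

Definition resolvent_set : set R[i] :=
  [set z | set_bij D E (fun u => z *: u - A u) /\
           (op_norm (resolvent z) < +oo)%E].

Definition spectrum : set R[i] := ~` resolvent_set.

Definition sectorial (omega : R) : Prop :=
  spectrum `<=` closure (sector omega) /\
  (ereal_sup [set op_norm (fun f => lambda *: resolvent lambda f)
             | lambda in ~` closure (sector omega)] < +oo)%E.

End operators.

(* Main.v *)
(* A function in B^0 is c^-1 times the unnormalised inverse Fourier transform of
  an integrable [g], and on the Fourier side [lambda - A] is multiplication by
  lambda - |xi|^2.  The complement of the closed sector consists of lambda with
  Re lambda < 0, where |lambda| <= |lambda - |xi|^2|, so multiplication of [g]
  by lambda / (lambda - |xi|^2) is a contraction of L^1: the resolvent satisfies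
  |lambda| ||(lambda - A)^-1|| <= 1.

  Fourier inversion is obtained by testing <f^, phi> = <f, phi^> with
  phi(xi) = chi(e xi) exp(i a.xi), for a bump [chi] and e -> 0.  This gives the
  inversion formula up to a constant c; its value (2 pi)^n is never needed, only
  that c != 0, which follows from c int chi^2 = int |chi^|^2.

  If u in B^0, with Fourier transform h, solves lambda u + Delta u = 0 as a
  distribution, then testing with all translates of a bump [phi] shows that the
  integrable function h (lambda - |xi|^2) phi^ has vanishing Fourier transform;
  hence it is null, and dilating [phi] gives h = 0 almost everywhere. *)

From HB Require Import structures.
Require Import Defs.
From mathcomp Require Import all_boot all_order all_algebra.
From mathcomp Require Import complex.
From mathcomp Require Import all_classical all_reals all_analysis.
From mathcomp Require Import measurable_realfun ring lra.

Set Implicit Arguments.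
Unset Strict Implicit.
Unset Printing Implicit Defensive.

Import Order.TTheory GRing.Theory Num.Theory.
Import numFieldNormedType.Exports.

Local Open Scope classical_set_scope.
Local Open Scope ring_scope.

(** * Complex numbers *)

(** Three choices carry the analysis. Every test function comes from one family of product bumps,
    built from exp(-1/t) in each coordinate: sharpened, they approximate indicators of boxes and
    detect null functions; dilated, they give inversion and injectivity. Integrability of Schwartz
    functions and of their transforms comes from one weight, the product of the (1 + x_i^2)^-1.
    Limits are taken along sequences, by dominated convergence on real and imaginary parts.

    The obstacle in injectivity is that a distributional equation may be tested only against
    compactly supported functions, so the transform of the test function cannot be prescribed and
    may have zeros. Translating a bump multiplies its transform by a character, and this turns the
    tested equations into the vanishing of a Fourier transform of an integrable function; dilating
    the bump moves the zeros away from any given frequency.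

    For surjectivity the explicit candidate lies in the domain because |xi|^2 / (lambda - |xi|^2) is
    bounded, so that its Laplacian again has an integrable transform. *)

Section cabs_theory.
Context {R : realType}.
Implicit Types (z w : R[i]) (t : R).
Local Notation Re := (@complex.Re R).
Local Notation Im := (@complex.Im R).

Lemma cabsE z : cabs z = Num.sqrt (Re z ^+ 2 + Im z ^+ 2).
Proof. by rewrite /cabs normc_def. Qed.

Lemma cabs_normc z : cabs z = Normc.normc z.
Proof. by rewrite cabsE; case: z. Qed.

Lemma cabs_ge0 z : 0 <= cabs z.
Proof. by rewrite cabsE sqrtr_ge0. Qed.

Lemma cabs0 : cabs (0 : R[i]) = 0.
Proof. by rewrite cabs_normc Normc.normc0. Qed.

Lemma cabs_eq0 z : (cabs z == 0) = (z == 0).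
Proof.
apply/eqP/eqP => [|->]; last exact: cabs0.
by rewrite cabs_normc => /Normc.eq0_normc.
Qed.

Lemma cabsM z w : cabs (z * w) = cabs z * cabs w.
Proof. by rewrite !cabs_normc Normc.normcM. Qed.

Lemma cabsV z : cabs z^-1 = (cabs z)^-1.
Proof. by rewrite !cabs_normc Normc.normcV. Qed.

Lemma cabsN z : cabs (- z) = cabs z.
Proof. by rewrite !cabs_normc normcN. Qed.

Lemma cabs_dist z w : cabs (z - w) = cabs (w - z).
Proof. by rewrite -cabsN opprB. Qed.

Lemma ler_cabsD z w : cabs (z + w) <= cabs z + cabs w.
Proof. by rewrite !cabs_normc le_normcD. Qed.

Lemma ler_dist_cabs z w : `|cabs z - cabs w| <= cabs (z - w).
Proof.
rewrite ler_distl; apply/andP; split.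
  by rewrite lerBlDr -{1}(subrK z w) addrC (cabs_dist z) ler_cabsD.
by rewrite -{1}(subrK w z) addrC ler_cabsD.
Qed.

Lemma ler_Re_cabs z : `|Re z| <= cabs z.
Proof.
by rewrite cabsE -[leLHS]sqrtr_sqr; apply: ler_wsqrtr; rewrite lerDl sqr_ge0.
Qed.

Lemma ler_Im_cabs z : `|Im z| <= cabs z.
Proof.
by rewrite cabsE -[leLHS]sqrtr_sqr; apply: ler_wsqrtr; rewrite lerDr sqr_ge0.
Qed.

Lemma ler_cabs_ReIm z : cabs z <= `|Re z| + `|Im z|.
Proof.
rewrite cabsE -[leRHS]ger0_norm ?addr_ge0 // -sqrtr_sqr; apply: ler_wsqrtr.
rewrite sqrrD !real_normK ?num_real //.
by rewrite lerD2r lerDl mulrn_wge0 // mulr_ge0.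
Qed.

Lemma cabs_real t : cabs t%:C%C = `|t|.
Proof. by rewrite cabsE /= expr0n addr0 sqrtr_sqr. Qed.

Lemma cabs_i : cabs ('i%C : R[i]) = 1.
Proof. by rewrite cabsE /= expr0n add0r expr1n sqrtr1. Qed.

Lemma cabs_expi t : cabs (expi t) = 1.
Proof. by rewrite cabsE /= cos2Dsin2 sqrtr1. Qed.

Lemma expi0 : expi (0 : R) = 1.
Proof. by rewrite /expi cos0 sin0. Qed.

Lemma expiD s t : expi (s + t) = expi s * expi t.
Proof.
rewrite /expi cosD sinD; apply/eqP; rewrite eq_complex /=.
by apply/andP; split; apply/eqP; ring.
Qed.

(* [Num.Theory.ReD] etc. are about ['Re] in a [numClosedFieldType], not about
  the projection [complex.Re]. *)
Lemma cReD z w : Re (z + w) = Re z + Re w. Proof. by case: z; case: w. Qed.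
Lemma cImD z w : Im (z + w) = Im z + Im w. Proof. by case: z; case: w. Qed.
Lemma cReN z : Re (- z) = - Re z. Proof. by case: z. Qed.
Lemma cImN z : Im (- z) = - Im z. Proof. by case: z. Qed.
Lemma cReM z w : Re (z * w) = Re z * Re w - Im z * Im w.
Proof. by case: z; case: w. Qed.
Lemma cImM z w : Im (z * w) = Re z * Im w + Im z * Re w.
Proof. by case: z; case: w. Qed.

Lemma complex_eq z w : Re z = Re w -> Im z = Im w -> z = w.
Proof. by case: z; case: w => ? ? ? ? /= -> ->. Qed.

End cabs_theory.

Section ccvg.
Context {R : realType}.
Implicit Types (z w : R[i]) (u v : nat -> R[i]).
Local Notation Re := (@complex.Re R).
Local Notation Im := (@complex.Im R).

(** Stated through a real-valued distance, so that real squeezing and dominated convergence apply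
    and the two components can be treated separately. *)
Definition ccvg u z : Prop := cabs (u k - z) @[k --> \oo] --> 0.

Lemma ccvg_squeeze u z (b : nat -> R) : (forall k, cabs (u k - z) <= b k) ->
  b @ \oo --> 0 -> ccvg u z.
Proof.
move=> ub b0; apply: (squeeze_cvgr _ (cvg_cst 0) b0); apply: nearW => k.
by rewrite cabs_ge0 ub.
Qed.

Lemma ccvg_ReIm u z : ccvg u z <->
  (Re (u k) @[k --> \oo] --> Re z) /\ (Im (u k) @[k --> \oo] --> Im z).
Proof.
split=> [uz|[uz1 uz2]].
- split; apply/cvgrPdistC_lt => e e0;
    move/cvgrPdistC_lt : uz => /(_ _ e0); apply: filterS => k /=;
    rewrite subr0 ger0_norm ?cabs_ge0 //; apply: le_lt_trans.
  + by rewrite -cReN -cReD ler_Re_cabs.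
  + by rewrite -cImN -cImD ler_Im_cabs.
- apply: (ccvg_squeeze
    (b := fun k => `|Re (u k) - Re z| + `|Im (u k) - Im z|)).
    by move=> k; rewrite -cReN -cReD -cImN -cImD ler_cabs_ReIm.
  rewrite -[X in _ --> X]addr0; apply: cvgD.
    by apply/norm_cvg0P; apply/subr_cvg0.
  by apply/norm_cvg0P; apply/subr_cvg0.
Qed.

Lemma ccvg_unique u z w : ccvg u z -> ccvg u w -> z = w.
Proof.
move=> /ccvg_ReIm[z1 z2] /ccvg_ReIm[w1 w2].
by apply: complex_eq; [exact: (cvg_unique _ z1 w1)|exact: (cvg_unique _ z2 w2)].
Qed.

Lemma ccvg_cst z : ccvg (fun=> z) z.
Proof. by apply/ccvg_ReIm; split; exact: cvg_cst. Qed.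

Lemma ccvgM u v z w : ccvg u z -> ccvg v w -> ccvg (fun k => u k * v k) (z * w).
Proof.
move=> /ccvg_ReIm[z1 z2] /ccvg_ReIm[w1 w2]; apply/ccvg_ReIm.
under eq_fun do rewrite cReM; under [in X in _ /\ X]eq_fun do rewrite cImM.
by rewrite cReM cImM; split; [apply: cvgB|apply: cvgD]; exact: cvgM.
Qed.

Lemma ccvg_eq u v z : (forall k, u k = v k) -> ccvg u z -> ccvg v z.
Proof. by move=> /funext ->. Qed.

End ccvg.

Section ccontinuous.
Context {R : realType} {T : topologicalType}.
Implicit Types (f g : T -> R[i]) (x : T).

Lemma ccontinuousP f x : {for x, continuous f} <->
  forall e : R, 0 < e -> \forall y \near x, cabs (f y - f x) < e.
Proof.
split=> [fx e e0|fx].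
  have : 0 < e%:C%C by rewrite ltcR.
  move=> e0'; move/cvgrPdist_lt: fx => /(_ _ e0'); apply: filterS => y.
  by rewrite normc_def ltcR cabs_dist cabsE.
(* Radii in [R[i]] are themselves complex; positivity forces the imaginary part to be 0, so only
   real radii have to be handled. *)
apply/cvgrPdist_lt => -[e ei]; rewrite ltcE /= => /andP[/eqP -> e0].
move: (fx _ e0); apply: filterS => y.
by rewrite normc_def ltcR cabs_dist cabsE.
Qed.

Lemma ccontinuous_ReIm f x : {for x, continuous f} <->
  {for x, continuous (fun y => complex.Re (f y))} /\
  {for x, continuous (fun y => complex.Im (f y))}.
Proof.
split=> [/ccontinuousP fx|[/cvgr_dist_lt fx /cvgr_dist_lt fx']].
  split; apply/cvgrPdist_lt => e e0; move: (fx _ e0); apply: filterS => y /=.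
    by apply: le_lt_trans; rewrite cabs_dist -cReN -cReD ler_Re_cabs.
  by apply: le_lt_trans; rewrite cabs_dist -cImN -cImD ler_Im_cabs.
apply/ccontinuousP => e e0; have e20 : 0 < e / 2 by rewrite divr_gt0.
apply: filterS2 (fx _ e20) (fx' _ e20) => y /= h1 h2.
rewrite cabs_dist (le_lt_trans (ler_cabs_ReIm _)) //.
by rewrite cReD cReN cImD cImN (splitr e) ltrD.
Qed.

Lemma continuous_cabs f : continuous f -> continuous (fun x => cabs (f x)).
Proof.
move=> cf x; have /ccontinuousP fx := cf x.
apply/cvgrPdist_lt => e e0; move: (fx _ e0); apply: filterS => y.
by apply: le_lt_trans; rewrite cabs_dist ler_dist_cabs.
Qed.

End ccontinuous.

(** * Complex-valued integrals *)

Section cmeasurable.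
Context {R : realType}.

Definition cmeasurable d (T : measurableType d) (f : T -> R[i]) : Prop :=
  measurable_fun setT (fun x => complex.Re (f x)) /\
  measurable_fun setT (fun x => complex.Im (f x)).

Lemma cmeasurable_cst d (T : measurableType d) (z : R[i]) :
  cmeasurable (fun _ : T => z).
Proof. by split; exact: measurable_cst. Qed.

Lemma cmeasurableD d (T : measurableType d) (f g : T -> R[i]) :
  cmeasurable f -> cmeasurable g -> cmeasurable (fun x => f x + g x).
Proof.
move=> [? ?] [? ?]; split; [under eq_fun do rewrite cReD|
  under eq_fun do rewrite cImD]; exact: measurable_funD.
Qed.

Lemma cmeasurableM d (T : measurableType d) (f g : T -> R[i]) :
  cmeasurable f -> cmeasurable g -> cmeasurable (fun x => f x * g x).
Proof.
move=> [? ?] [? ?]; split.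
  under eq_fun do rewrite cReM.
  by apply: measurable_funB; exact: measurable_funM.
under eq_fun do rewrite cImM.
by apply: measurable_funD; exact: measurable_funM.
Qed.

Lemma cmeasurable_comp d d' (T : measurableType d) (U : measurableType d')
    (f : U -> R[i]) (g : T -> U) :
  cmeasurable f -> measurable_fun setT g -> cmeasurable (fun x => f (g x)).
Proof.
move=> [m1 m2] mg; split; first exact: (measurableT_comp m1).
exact: (measurableT_comp m2).
Qed.

Lemma cmeasurable_expi d (T : measurableType d) (t : T -> R) :
  measurable_fun setT t -> cmeasurable (fun x => expi (t x)).
Proof.
move=> mt; split => /=.
  apply: (measurableT_comp (f := @cos R)) => //.
  by apply: continuous_measurable_fun; exact: continuous_cos.
apply: (measurableT_comp (f := @sin R)) => //.
by apply: continuous_measurable_fun; exact: continuous_sin.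
Qed.

Lemma measurable_cabs d (T : measurableType d) (f : T -> R[i]) :
  cmeasurable f -> measurable_fun setT (fun x => cabs (f x)).
Proof.
move=> [? ?]; under eq_fun do rewrite cabsE.
apply: (measurableT_comp (f := @Num.sqrt R)).
  by apply: continuous_measurable_fun; exact: sqrt_continuous.
by apply: measurable_funD; exact: measurable_funX.
Qed.

End cmeasurable.

Section real_dominated.
Context d {T : measurableType d} {R : realType} (mu : {measure set T ->
  \bar R}).

Lemma integrable_le (f g : T -> R) : measurable_fun setT f ->
  mu.-integrable setT (EFin \o g) -> (forall x, `|f x| <= g x) ->
  mu.-integrable setT (EFin \o f).
Proof.
move=> mf ig fg; apply: (le_integrable _ _ _ ig) => //.
  exact/measurable_EFinP.
by move=> x _ /=; rewrite lee_fin (le_trans (fg x)) // ler_norm.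
Qed.

Lemma integrableZl_EFin (r : R) (f : T ->
  R) : mu.-integrable setT (EFin \o f) ->
  mu.-integrable setT (EFin \o (fun x => r * f x)).
Proof.
move=> fi; rewrite (_ : _ \o _ = fun x => (r%:E * (f x)%:E)%E) //.
exact: integrableZl.
Qed.

Lemma Rintegral_dominated_cvg (u : nat -> T -> R) (f g : T -> R) :
  (forall k, measurable_fun setT (u k)) -> measurable_fun setT f ->
  mu.-integrable setT (EFin \o g) ->
  (forall x, u k x @[k --> \oo] --> f x) -> (forall k x, `|u k x| <= g x) ->
  (\int[mu]_x u k x) @[k --> \oo] --> \int[mu]_x f x.
Proof.
move=> mu_ mf ig uf ug; rewrite /Rintegral.
have [fi _ h] : [/\ mu.-integrable setT (EFin \o f),
    [sequence (\int[mu]_x `|(u k x)%:E - (f x)%:E|)%E]_k @ \oo --> 0%E &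
    [sequence (\int[mu]_x (u k x)%:E)%E]_k @ \oo --> (\int[mu]_x (f x)%:E)%E].
  apply: (@dominated_convergence _ _ _ mu setT measurableT _ _ (EFin \o g)) =>
    //.
  - by move=> k; exact/measurable_EFinP.
  - exact/measurable_EFinP.
  - by apply: aeW => x _; apply: cvg_EFin; [exact: nearW|exact: uf].
  - by apply: aeW => x k _ /=; rewrite lee_fin.
apply: fine_cvg; rewrite fineK //; exact: integrable_fin_num.
Qed.

End real_dominated.

Section cintegral_theory.
Context {R : realType} {n : nat}.
Implicit Types f g : 'rV[R]_n -> R[i].
Local Notation mu := (@lebesgue_row R n).

Lemma cintegrable_measurable f : cintegrable f -> cmeasurable f.
Proof.
by move=> [/measurable_int /measurable_EFinP ? /measurable_int
  /measurable_EFinP].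
Qed.

Lemma integrable_cabs f :
  cintegrable f -> mu.-integrable setT (EFin \o (fun x => cabs (f x))).
Proof.
move=> fi; have mf := cintegrable_measurable fi; case: fi => f1 f2.
apply: (integrable_le (g := fun x => `|complex.Re (f x)| + `|complex.Im (f
  x)|)).
- exact: measurable_cabs.
- by apply: (integrableD _ (integrable_norm f1) (integrable_norm f2)).
- by move=> x; rewrite ger0_norm ?cabs_ge0 // ler_cabs_ReIm.
Qed.

Lemma cintegrable_le f (g : 'rV[R]_n -> R) : cmeasurable f ->
  mu.-integrable setT (EFin \o g) -> (forall x, cabs (f x) <= g x) ->
  cintegrable f.
Proof.
move=> [mf1 mf2] ig fg; split; apply: (integrable_le _ ig) => // x.
  by rewrite (le_trans (ler_Re_cabs _)).
by rewrite (le_trans (ler_Im_cabs _)).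
Qed.

Lemma cintegrableMl (M : R) f g : cmeasurable g ->
  (forall x, cabs (g x) <= M) ->
  cintegrable f -> cintegrable (fun x => g x * f x).
Proof.
move=> mg gM fi; apply: (cintegrable_le (g := fun x => M * cabs (f x))).
- by apply: cmeasurableM => //; exact: cintegrable_measurable.
- by apply: integrableZl_EFin; exact: integrable_cabs.
- by move=> x; rewrite cabsM ler_wpM2r ?cabs_ge0.
Qed.

Lemma cintegrableZ (z : R[i]) f : cintegrable f ->
  cintegrable (fun x => z * f x).
Proof. by apply: (@cintegrableMl (cabs z)) => //; exact: cmeasurable_cst. Qed.

Lemma cintegrableD f g : cintegrable f -> cintegrable g ->
  cintegrable (fun x => f x + g x).
Proof.
move=> fi gi; apply: (cintegrable_le (g := fun x => cabs (f x) + cabs (g x))).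
- by apply: cmeasurableD; exact: cintegrable_measurable.
- by apply: (integrableD _ (integrable_cabs fi) (integrable_cabs gi)).
- by move=> x; exact: ler_cabsD.
Qed.

Lemma cintegralD f g : cintegrable f -> cintegrable g ->
  cintegral (fun x => f x + g x) = cintegral f + cintegral g.
Proof.
move=> [f1 f2] [g1 g2]; apply: complex_eq; rewrite ?cReD ?cImD /=.
  by under eq_Rintegral do rewrite cReD; rewrite RintegralD.
by under eq_Rintegral do rewrite cImD; rewrite RintegralD.
Qed.

Lemma cintegralZ (z : R[i]) f : cintegrable f ->
  cintegral (fun x => z * f x) = z * cintegral f.
Proof.
move=> [f1 f2]; apply: complex_eq; rewrite ?cReM ?cImM /=.
  under eq_Rintegral do rewrite cReM.
  by rewrite RintegralB ?RintegralZl //; exact: integrableZl_EFin.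
under eq_Rintegral do rewrite cImM.
by rewrite RintegralD ?RintegralZl //; exact: integrableZl_EFin.
Qed.

Lemma cintegralN f : cintegrable f -> cintegral (fun x => - f x) =
  - cintegral f.
Proof.
by move=> fi; under eq_fun do rewrite -mulN1r; rewrite cintegralZ // mulN1r.
Qed.

Lemma cintegrableN f : cintegrable f -> cintegrable (fun x => - f x).
Proof. by under eq_fun do rewrite -mulN1r; exact: cintegrableZ. Qed.

Lemma cintegralB f g : cintegrable f -> cintegrable g ->
  cintegral (fun x => f x - g x) = cintegral f - cintegral g.
Proof.
move=> fi gi; rewrite cintegralD // ?cintegralN //; exact: cintegrableN.
Qed.

Lemma cintegral0 : cintegral (fun _ : 'rV[R]_n => 0) = 0 :> R[i].
Proof. by apply: complex_eq; rewrite /= /Rintegral integral0. Qed.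

(* The factor 2 comes from bounding the real and imaginary parts separately. *)
Lemma ler_cabs_cintegral f : cintegrable f ->
  cabs (cintegral f) <= 2 * L1norm f.
Proof.
move=> fi; case: (fi) => f1 f2; have fc := integrable_cabs fi.
have le (h : 'rV[R]_n -> R) : mu.-integrable setT (EFin \o h) ->
    (forall x, `|h x| <= cabs (f x)) -> `|\int[mu]_x h x| <= L1norm f.
  move=> ih hf; apply: (le_trans (le_normr_Rintegral _ ih)) => //.
  by apply: le_Rintegral => //; exact: integrable_norm.
rewrite (le_trans (ler_cabs_ReIm _)) // mulr_natl mulr2n lerD // le //= => x.
  exact: ler_Re_cabs.
exact: ler_Im_cabs.
Qed.

Lemma cintegral_ccvg (u : nat -> 'rV[R]_n -> R[i]) f (g : 'rV[R]_n -> R) :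
  (forall k, cmeasurable (u k)) -> cmeasurable f ->
  mu.-integrable setT (EFin \o g) ->
  (forall x, ccvg (u ^~ x) (f x)) -> (forall k x, cabs (u k x) <= g x) ->
  ccvg (fun k => cintegral (u k)) (cintegral f).
Proof.
move=> mu_ [mf1 mf2] ig uf ug; apply/ccvg_ReIm; split;
  apply: (Rintegral_dominated_cvg _ _ ig) => //.
- by move=> k; have [] := mu_ k.
- by move=> x; have /ccvg_ReIm[] := uf x.
- by move=> k x; rewrite (le_trans (ler_Re_cabs _)).
- by move=> k; have [] := mu_ k.
- by move=> x; have /ccvg_ReIm[] := uf x.
- by move=> k x; rewrite (le_trans (ler_Im_cabs _)).
Qed.

End cintegral_theory.

(** * Fubini's theorem under a product bound *)

Section real_fubini.
Context d1 d2 {T1 : measurableType d1} {T2 : measurableType d2} {R : realType}.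
Variables (m1 : {sigma_finite_measure set T1 -> \bar R}).
Variables (m2 : {sigma_finite_measure set T2 -> \bar R}).
Variables (F : T1 * T2 -> R) (a : T1 -> R) (b : T2 -> R).
Hypotheses (mF : measurable_fun setT F) (ia : m1.-integrable setT (EFin \o a)).
Hypotheses (ib : m2.-integrable setT (EFin \o b)).
Hypothesis Fab : forall x y, `|F (x, y)| <= a x * b y.

Let mEF : measurable_fun setT (EFin \o F). Proof. exact/measurable_EFinP. Qed.

(** By Tonelli, the iterated integral of |F| is at most the product of the integrals of |a| and
    |b|. *)
Lemma integrable_prod_le : (m1 \x m2)%E.-integrable setT (EFin \o F).
Proof.
apply/integrable12ltyP => //.
have ma := measurable_int _ ia; have mb := measurable_int _ ib.
have b0 : (\int[m2]_y `|(b y)%:E|)%E \is a fin_num.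
  have := integrable_fin_num measurableT (integrable_abse ib).
  by rewrite /comp.
apply: (@le_lt_trans _ _
    (\int[m1]_x (`|(a x)%:E| * \int[m2]_y `|(b y)%:E|))%E).
  apply: ge0_le_integral => //.
  - by move=> x _; exact: integral_ge0.
  - apply: (measurable_fun_fubini_tonelli_F (abse \o (EFin \o F))) => //=.
    exact: measurableT_comp.
  - by apply: emeasurable_funM => //; exact: measurableT_comp.
  - move=> x _; rewrite -ge0_integralZl //; last exact: measurableT_comp.
    apply: ge0_le_integral => //.
    + apply: measurableT_comp => //; apply/measurable_EFinP.
      exact: measurableT_comp mF (measurable_pair1 x).
    + by apply: emeasurable_funM => //; exact: measurableT_comp.
    + move=> y _ /=; rewrite -EFinM lee_fin -normrM.
      by rewrite (le_trans (Fab x y)) // ler_norm.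
rewrite ge0_integralZr //; [|exact: measurableT_comp|exact: integral_ge0].
apply: lte_mul_pinfty; rewrite ?integral_ge0 //.
  have := integrable_fin_num measurableT (integrable_abse ia).
  by rewrite /comp.
by rewrite -ge0_fin_numE // integral_ge0.
Qed.

Let sec1 x : m2.-integrable setT (fun y => (F (x, y))%:E).
Proof.
apply: (@integrable_le _ _ _ m2 (fun y => F (x, y)) (fun y => a x * b y)) => //.
- exact: measurableT_comp mF (measurable_pair1 x).
- exact: integrableZl_EFin.
Qed.

Let sec2 y : m1.-integrable setT (fun x => (F (x, y))%:E).
Proof.
apply: (@integrable_le _ _ _ m1 (fun x => F (x, y)) (fun x => b y * a x)) => //.
- exact: measurableT_comp mF (measurable_pair2 y).
- exact: integrableZl_EFin.
- by move=> x; rewrite mulrC.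
Qed.

(** The bound holds at every point, so every section of [F], and not just almost every one, is
    integrable. Hence the [fine] inside each inner [Rintegral] can be undone for all parameters
    before Fubini is applied to extended reals. *)
Lemma Rfubini : \int[m1]_x \int[m2]_y F (x, y) = \int[m2]_y \int[m1]_x F (x, y).
Proof.
have E1 x : ((\int[m2]_y F (x, y))%:E = \int[m2]_y (F (x, y))%:E)%E.
  by rewrite /Rintegral fineK //; exact: integrable_fin_num (sec1 x).
have E2 y : ((\int[m1]_x F (x, y))%:E = \int[m1]_x (F (x, y))%:E)%E.
  by rewrite /Rintegral fineK //; exact: integrable_fin_num (sec2 y).
rewrite [LHS]/Rintegral [RHS]/Rintegral.
under eq_integral do rewrite E1; under [in RHS]eq_integral do rewrite E2.
by congr fine; exact: (@Fubini _ _ _ _ _ m1 m2 (EFin \o F) integrable_prod_le).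
Qed.

End real_fubini.

Section complex_fubini.
Context {R : realType} {n m : nat}.
Variables (F : 'rV[R]_n * 'rV[R]_m -> R[i]) (a : 'rV[R]_n ->
  R) (b : 'rV[R]_m -> R).
Hypotheses (mF : cmeasurable F).
Hypotheses (ia : (lebesgue_row n).-integrable setT (EFin \o a)).
Hypotheses (ib : (lebesgue_row m).-integrable setT (EFin \o b)).
Hypothesis Fab : forall x y, cabs (F (x, y)) <= a x * b y.

Let FRe x y : `|complex.Re (F (x, y))| <= a x * b y.
Proof. exact: le_trans (ler_Re_cabs _) (Fab x y). Qed.
Let FIm x y : `|complex.Im (F (x, y))| <= a x * b y.
Proof. exact: le_trans (ler_Im_cabs _) (Fab x y). Qed.

Lemma cintegral_fubini : cintegral (fun x => cintegral (fun y => F (x, y))) =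
  cintegral (fun y => cintegral (fun x => F (x, y))).
Proof.
have [m1 m2] := mF.
apply: complex_eq; [exact: (Rfubini m1 ia ib FRe)|exact: (Rfubini m2 ia ib
  FIm)].
Qed.

End complex_fubini.

(** * Lebesgue measure on R^n *)

Section open_boxes.
Context {R : realType} {n : nat}.
Local Notation mu := (@lebesgue_row R n).

Definition open_box (a b : 'I_n -> R) : set 'rV[R]_n :=
  row_box (fun i => `]a i, b i[%classic).

Definition open_boxes : set_system 'rV[R]_n :=
  [set B | exists a b, B = open_box a b].

Definition centered_box (k : nat) : set 'rV[R]_n :=
  open_box (fun=> - k%:R) (fun=> k%:R).

Lemma open_boxP a b (x : 'rV[R]_n) :
  open_box a b x <-> forall i, a i < x ord0 i < b i.
Proof. by split=> h i; move: (h i); rewrite /= in_itv. Qed.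

Lemma bigcup_centered_box : \bigcup_k centered_box k = setT.
Proof.
apply/seteqP; split => // x _.
pose M := \sum_(i < n) `|x ord0 i|.
have xM i : `|x ord0 i| <= M.
  by rewrite /M (bigD1 i) //= lerDl sumr_ge0.
exists (Num.truncn M).+1 => //; apply/open_boxP => i; rewrite -ltr_norml.
apply: (le_lt_trans (xM i)); exact: truncnS_gt.
Qed.

Lemma measurable_open_box a b : measurable (open_box a b).
Proof. by apply: measurable_row_box => i; exact: measurable_itv. Qed.

Lemma setI_closed_open_boxes : setI_closed open_boxes.
Proof.
move=> A B [a [b ->]] [a' [b' ->]].
exists (fun i => Num.max (a i) (a' i)), (fun i => Num.min (b i) (b' i)).
apply/seteqP; split => x.
  move=> [/open_boxP h /open_boxP h']; apply/open_boxP => i.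
  by move: (h i) (h' i); rewrite gt_max lt_min => /andP[-> ->] /andP[-> ->].
move=> /open_boxP h; split; apply/open_boxP => i; move: (h i);
  by rewrite gt_max lt_min => /andP[/andP[? ?] /andP[? ?]]; apply/andP.
Qed.

Lemma measurable_open_boxes : @measurable _ 'rV[R]_n = <<s open_boxes >>.
Proof.
apply/seteqP; split; last first.
  by apply: smallest_sub; [exact: sigma_algebra_measurable|
    move=> B [a [b ->]]; exact: measurable_open_box].
apply: smallest_sub; first exact: smallest_sigma_algebra.
move=> B; rewrite -bigcup_seq => -[i _ [C mC <-]]; rewrite setTI.
have coor_sigma : sigma_algebra [set: R]
    [set C : set R | <<s open_boxes >> ((fun x : 'rV[R]_n =>
      x ord0 i) @^-1` C)].
  have [s0 sC sU] := smallest_sigma_algebra [set: 'rV[R]_n] open_boxes.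
  split; rewrite /= ?preimage_set0 //.
  - by move=> A hA; rewrite setTD preimage_setC -setTD; exact: sC.
  - by move=> A hA; rewrite preimage_bigcup; exact: sU.
move: C mC; change (measurable `<=` [set C : set (measurableTypeR R) |
  <<s open_boxes >> ((fun x : 'rV[R]_n => x ord0 i) @^-1` C)]).
have -> : @measurable _ (measurableTypeR R) = <<s @RGenOInfty.G R >>.
  exact: RGenOInfty.measurableE.
apply: smallest_sub => // _ [r ->] /=.
have [s0 sC sU] := smallest_sigma_algebra [set: 'rV[R]_n] open_boxes.
(* The half-space x_i > r is exhausted by the boxes with i-th side ]r, k[ and all other sides ]-k,
   k[, a countable union. *)
rewrite (_ : _ @^-1` _ = \bigcup_k open_box
    (fun j => if j == i then r else - k%:R) (fun=> k%:R)).
  by apply: sU => k; apply: sub_sigma_algebra; eexists; eexists.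
apply/seteqP; split => x /=; rewrite in_itv /= andbT.
  move=> rx; have : [set: 'rV[R]_n] x by [].
  rewrite -bigcup_centered_box => -[k _ /open_boxP h].
  exists k => //; apply/open_boxP => j; case: eqP => [->|_]; last exact: h.
  by rewrite rx /=; have /andP[] := h i.
by move=> [k _ /open_boxP /(_ i)]; rewrite eqxx => /andP[].
Qed.

Lemma lebesgue_row_open_box a b :
  mu (open_box a b) = (\prod_(i < n) Num.max 0 (b i - a i))%:E.
Proof.
rewrite lebesgue_row_box; last by move=> i; exact: measurable_itv.
elim/big_rec2: _ => // i x y _ ->; rewrite EFinM; congr (_ * _)%E.
rewrite lebesgue_measure_itv /= lte_fin; case: ltP => ab.
  by rewrite -EFinB max_r // subr_ge0 ltW.
by rewrite max_l // subr_le0.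
Qed.

Lemma lebesgue_row_open_box_lty a b : (mu (open_box a b) < +oo)%E.
Proof. by rewrite lebesgue_row_open_box ltry. Qed.

Lemma lebesgue_row_unique (m1 m2 : {measure set 'rV[R]_n -> \bar R}) :
  (forall a b, m1 (open_box a b) = m2 (open_box a b)) ->
  (forall k, (m1 (centered_box k) < +oo)%E) ->
  forall A, measurable A -> m1 A = m2 A.
Proof.
move=> m12 m1oo; apply: (measure_unique open_boxes centered_box) => //.
- exact: measurable_open_boxes.
- exact: setI_closed_open_boxes.
- by move=> k; eexists; eexists.
- exact: bigcup_centered_box.
- by move=> _ [a [b ->]].
Qed.

End open_boxes.

(** * Translations and positive dilations of Lebesgue measure *)

Section affine.
Context {R : realType} {n : nat} (a : 'rV[R]_n) (e : R).
Hypothesis e0 : 0 < e.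
Local Notation mu := (@lebesgue_row R n).

Definition affine_row (x : 'rV[R]_n) : 'rV[R]_n := a + e *: x.

Lemma measurable_affine_row : measurable_fun setT affine_row.
Proof.
apply: measurable_fun_row => i; under eq_fun do rewrite !mxE.
apply: measurable_funD => //; apply: measurable_funM => //.
exact: measurable_coor.
Qed.

Let push : {measure set 'rV[R]_n -> \bar R}.
Proof.
by unshelve refine (pushforward mu affine_row : {measure set _ -> \bar R});
  exact: measurable_affine_row.
Defined.

Let c : {nonneg R} := NngNum (ltW (exprn_gt0 n e0)).

Let preim_open_box (l r : 'I_n -> R) : affine_row @^-1` open_box l r =
  open_box (fun i => (l i - a ord0 i) / e) (fun i => (r i - a ord0 i) / e).
Proof.
apply/seteqP; split => x /open_boxP h; apply/open_boxP => i; move: (h i).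
  rewrite !mxE ltr_pdivrMr // ltr_pdivlMr // ltrBlDl ltrBrDl.
  by rewrite (mulrC (x _ _)).
rewrite !mxE ltr_pdivrMr // ltr_pdivlMr // ltrBlDl ltrBrDl.
by rewrite (mulrC (x _ _)).
Qed.

(** Both sides are measures in [A], the left one a rescaled pushforward. The preimage of an open box
    is an open box with each side divided by [e], so they agree on boxes, which determine the
    measure. *)
Lemma lebesgue_row_affine (A : set 'rV[R]_n) : measurable A ->
  ((e ^+ n)%:E * mu (affine_row @^-1` A) = mu A)%E.
Proof.
have box l r : mscale c push (open_box l r) =
    mu (open_box l r).
  rewrite /mscale /= /pushforward preim_open_box !lebesgue_row_open_box -EFinM.
  congr EFin; rewrite -[n in e ^+ n]card_ord -prodr_const -big_split /=.
  apply: eq_bigr => i _; rewrite maxr_pMr ?ltW // mulr0 -mulrBl.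
  by rewrite opprB addrA subrK mulrC divfK // gt_eqF.
apply: (lebesgue_row_unique (m1 := mscale c push)) => //.
by move=> k; rewrite [X in (X < _)%E]box lebesgue_row_open_box_lty.
Qed.

Lemma integral_affine_row (f : 'rV[R]_n -> \bar R) : measurable_fun setT f ->
  (forall x, 0 <= f x)%E ->
  ((e ^+ n)%:E * \int[mu]_x f (a + e *: x)%R = \int[mu]_x f x)%E.
Proof.
move=> mf f0.
rewrite [RHS](eq_measure_integral (mscale c push)); last first.
  by move=> A mA _; exact/esym/lebesgue_row_affine.
rewrite ge0_integral_mscale //; congr (_ * _)%E.
by rewrite ge0_integral_pushforward //; exact: measurable_affine_row.
Qed.

Lemma integrable_affine_row (f : 'rV[R]_n -> R) :
  mu.-integrable setT (EFin \o f) ->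
  mu.-integrable setT (EFin \o (fun x => f (a + e *: x))).
Proof.
move=> fi; have mf := measurable_int _ fi.
apply/integrableP; split.
  exact: measurableT_comp mf measurable_affine_row.
move/integrableP : fi => [_].
rewrite -integral_affine_row //; last exact: measurableT_comp.
move=> h; rewrite ltNge leye_eq; apply/negP => /eqP E.
by move: h; rewrite E mulry gtr0_sg ?exprn_gt0 // mul1e.
Qed.

Lemma Rintegral_affine_row (f : 'rV[R]_n -> R) :
  mu.-integrable setT (EFin \o f) ->
  e ^+ n * \int[mu]_x f (a + e *: x) = \int[mu]_x f x.
Proof.
move=> fi; have mf := measurable_int _ fi.
have fin (g : 'rV[R]_n -> \bar R) : mu.-integrable setT g ->
    (\int[mu]_x g^\+ x)%E \is a fin_num /\ (\int[mu]_x g^\- x)%E \is a fin_num.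
  by move=> gi; split; apply: integrable_fin_num => //;
    [exact: integrable_funepos|exact: integrable_funeneg].
have [f1 f2] := fin _ fi.
have [g1 g2] := fin _ (integrable_affine_row fi).
have Ep := integral_affine_row (measurable_funepos mf) (fun=> funepos_ge0 _ _).
have En := integral_affine_row (measurable_funeneg mf) (fun=> funeneg_ge0 _ _).
have FE (g : 'rV[R]_n -> \bar R) : mu.-integrable setT g ->
    fine (\int[mu]_x g x)%E =
    fine (\int[mu]_x g^\+ x)%E - fine (\int[mu]_x g^\- x)%E.
  by move=> gi; have [? ?] := fin _ gi; rewrite integralE [LHS]fineB.
rewrite /Rintegral (FE _ fi) (FE _ (integrable_affine_row fi)) mulrBr.
rewrite (funepos_comp (EFin \o f) affine_row) in g1 *.
rewrite (funeneg_comp (EFin \o f) affine_row) in g2 *.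
congr (_ - _); first by rewrite -Ep [RHS]fineM //; exact: g1.
by rewrite -En [RHS]fineM //; exact: g2.
Qed.

End affine.

Section cintegral_affine.
Context {R : realType} {n : nat} (a : 'rV[R]_n) (e : R).
Hypothesis e0 : 0 < e.
Implicit Types f : 'rV[R]_n -> R[i].

Lemma cintegrable_affine f :
  cintegrable f -> cintegrable (fun x => f (a + e *: x)).
Proof.
move=> [f1 f2].
by split; [exact: (integrable_affine_row a e0 f1)|
  exact: (integrable_affine_row a e0 f2)].
Qed.

Lemma cintegral_affine f : cintegrable f ->
  (e ^+ n)%:C%C * cintegral (fun x => f (a + e *: x)) = cintegral f.
Proof.
move=> [f1 f2]; apply: complex_eq; rewrite ?cReM ?cImM /= mul0r ?subr0 ?addr0.
  exact: (Rintegral_affine_row a e0 f1).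
exact: (Rintegral_affine_row a e0 f2).
Qed.

End cintegral_affine.

(** * Lebesgue measure and the topology of R^n *)

Section row_topology.
Context {R : realType} {n : nat}.
Local Notation mu := (@lebesgue_row R n).
Implicit Types (x y : 'rV[R]_n) (A : set 'rV[R]_n).

Lemma nbhs_open_box x A : nbhs x A <->
  exists2 e : R, 0 < e & open_box (fun i => x ord0 i - e) (fun i =>
    x ord0 i + e) `<=` A.
Proof.
split.
  move=> /nbhs_ballP[e /= e0 xA]; exists e => // y /open_boxP h; apply: xA.
  split=> // i j; rewrite ord1 /ball /= ltr_distlC.
  exact: h.
move=> [e e0 xA]; apply/nbhs_ballP; exists e => //= y xy;
  apply/xA/open_boxP => i.
by rewrite -ltr_distlC; have [_] := xy; exact.
Qed.

(** The sigma-algebra is generated by coordinates, so openness has to be turned into countably many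
    box conditions: an open set is the union of the boxes with rational corners that it contains. *)
Lemma measurable_open_row A : open A -> measurable A.
Proof.
move=> oA.
pose B (ab : {ffun 'I_n -> rat} * {ffun 'I_n -> rat}) : set 'rV[R]_n :=
  open_box (fun i => ratr (ab.1 i)) (fun i => ratr (ab.2 i)).
rewrite (_ : A = \bigcup_ab (if `[< B ab `<=` A >] then B ab else set0)).
  apply: countable_bigcupT_measurable => [|ab]; first exact: countableP.
  by case: ifP => _ //; exact: measurable_open_box.
apply/seteqP; split => [x Ax|x [ab _]]; last by case: asboolP => // BA /BA.
have [e e0 xA] : exists2 e : R, 0 < e &
    open_box (fun i => x ord0 i - e) (fun i => x ord0 i + e) `<=` A.
  by apply/nbhs_open_box; exact: open_nbhs_nbhs.
have /choice[a ha] : forall i : 'I_n, exists q : rat,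
    ratr q \in `]x ord0 i - e, x ord0 i[.
  move=> i; have xe : x ord0 i - e < x ord0 i by rewrite ltrBlDr ltrDl.
  by have [q ?] := rat_in_itvoo xe; exists q.
have /choice[b hb] : forall i : 'I_n, exists q : rat,
    ratr q \in `]x ord0 i, x ord0 i + e[.
  move=> i; have xe : x ord0 i < x ord0 i + e by rewrite ltrDl.
  by have [q ?] := rat_in_itvoo xe; exists q.
have h i : x ord0 i - e < ratr (a i) < x ord0 i /\
    x ord0 i < ratr (b i) < x ord0 i + e.
  by move: (ha i) (hb i); rewrite !in_itv.
exists ([ffun i => a i], [ffun i => b i]) => //; case: asboolP => [_|].
  apply/open_boxP => i; rewrite !ffunE.
  by have [/andP[_ ->] /andP[->]] := h i.
case=> y /open_boxP hy; apply/xA/open_boxP => i.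
have := hy i; rewrite !ffunE => /andP[y1 y2].
have [/andP[h1 _] /andP[_ h2]] := h i.
by rewrite (lt_trans h1 y1) (lt_trans y2 h2).
Qed.

Lemma continuous_measurable_row (f : 'rV[R]_n -> R) :
  continuous f -> measurable_fun setT f.
Proof.
move=> cf; apply: (measurability _ (RGenOInfty.measurableE R)).
move=> /= _ [_ [r ->] <-]; rewrite setTI; apply: measurable_open_row.
by apply: open_comp => [x _|]; [exact: cf|exact: interval_open].
Qed.

Lemma continuous_cmeasurable (f : 'rV[R]_n -> R[i]) :
  continuous f -> cmeasurable f.
Proof.
by move=> cf; split; apply: continuous_measurable_row => x;
  have /ccontinuous_ReIm[] := cf x.
Qed.

Lemma lebesgue_row_nbhs_gt0 x A : nbhs x A -> measurable A -> (0 < mu A)%E.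
Proof.
move=> /nbhs_open_box[e e0 xA] mA.
have : (0 < mu (open_box (fun i => x ord0 i - e)%R (fun i =>
  x ord0 i + e)%R))%E.
  rewrite lebesgue_row_open_box lte_fin; apply: prodr_gt0 => i _.
  by rewrite lt_max; apply/orP; right; lra.
move/lt_le_trans; apply; apply: le_measure => //; rewrite ?inE //.
exact: measurable_open_box.
Qed.

Lemma continuous_ae0 (f : 'rV[R]_n -> R) : continuous f ->
  ae_eq mu setT (EFin \o f) (cst 0%E) -> forall x, f x = 0.
Proof.
move=> cf [N [mN N0 fN]] x; apply/eqP/negPn/negP => fx0.
have oA : open [set y | f y != 0].
  apply: (open_comp (f := f) (D := [set t | t != 0])) => [y _|];
    first exact: cf.
  exact: open_neq.
have : (mu [set y | f y != 0%R] <= mu N)%E.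
  apply: le_measure; rewrite ?inE //; first exact: measurable_open_row.
  move=> y /= fy; apply: fN => /= /(_ I) [] /eqP; exact/negP.
rewrite N0 leNgt => /negP; apply; apply: (@lebesgue_row_nbhs_gt0 x).
  exact: open_nbhs_nbhs.
exact: measurable_open_row.
Qed.

(** Dynkin's argument: the sets over which [f] integrates to zero are closed under complements and
    countable disjoint unions, and the open boxes are a generating pi-system. The step to
    complements requires that the integral over the whole space vanish, which follows by exhausting
    it with centered boxes. *)
Lemma Rintegral_open_box_ae0 (f : 'rV[R]_n -> R) :
  mu.-integrable setT (EFin \o f) ->
  (forall a b, \int[mu]_(x in open_box a b) f x = 0) ->
  ae_eq mu setT (EFin \o f) (cst 0%E).
Proof.
move=> fi fbox; have mf : measurable_fun setT f.
  by have /measurable_EFinP := measurable_int mu fi.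
have fiS A : measurable A -> mu.-integrable A (EFin \o f).
  by move=> mA; apply: integrableS fi.
have boxE a b : (\int[mu]_(x in open_box a b) (f x)%:E = 0)%E.
  have mB := @measurable_open_box R n a b.
  by rewrite -(fineK (integrable_fin_num mB (fiS _ mB))) [fine _]fbox.
have f0 A : measurable A -> (\int[mu]_(x in A) (f x)%:E = 0)%E.
  move=> mA.
  have mU (F : nat -> set 'rV[R]_n) : (forall k, measurable (F k)) ->
      trivIset setT F -> (forall k, \int[mu]_(x in F k) (f x)%:E = 0)%E ->
      (\int[mu]_(x in \bigcup_k F k) (f x)%:E = 0)%E.
    move=> mF tF F0; rewrite integral_bigcup //; last first.
      by apply: fiS; exact: bigcupT_measurable.
    by rewrite eseries0.
  have f0T : (\int[mu]_x (f x)%:E = 0)%E.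
    rewrite -(fineK (integrable_fin_num measurableT fi)); congr EFin.
    have : (\int[mu]_x (f \_ (centered_box k)) x) @[k --> \oo] -->
      \int[mu]_x f x.
      apply: (Rintegral_dominated_cvg _ _ (integrable_norm fi)).
      - move=> k; apply/(measurable_restrictT _ _).1 => //.
          exact: measurable_open_box.
        exact: measurable_funTS.
      - exact: mf.
      - move=> x; have : [set: 'rV[R]_n] x by [].
        rewrite -bigcup_centered_box => -[k _ /open_boxP xk].
        apply: (cvg_near_cst (f x)); exists k => // j /= kj.
        rewrite patchE mem_set //; apply/open_boxP => i.
        have kjR : k%:R <= j%:R :> R by rewrite ler_nat.
        have /andP[h1 h2] := xk i.
        by rewrite (lt_le_trans h2 kjR) andbT (le_lt_trans _ h1) // lerN2.
      - by move=> k x; rewrite /= patchE; case: ifP => // _; rewrite normr0.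
    under eq_fun do rewrite -Rintegral_mkcond fbox.
    by move=> h; exact: (cvg_unique _ h (cvg_cst _)).
  apply: (dynkin_induction (G := open_boxes)
    (P := fun A => \int[mu]_(x in A) (f x)%:E = 0)%E) => //.
  - exact: measurable_open_boxes.
  - exact: setI_closed_open_boxes.
  - by move=> _ [a [b ->]].
  - move=> S mS S0; move: f0T; rewrite -(setUv S) integral_setU_EFin //.
    + by rewrite S0 add0e.
    + exact: measurableC.
    + by rewrite setUv.
    + by apply/eqP; rewrite setICr.
  - by rewrite -measurable_open_boxes.
apply: integral_ae_eq => // E _ mE.
by rewrite [LHS]f0 // integral0.
Qed.

End row_topology.

(** * An integrable weight on R^n *)

Section decay.
Context {R : realType}.

Lemma integrable_oneDsqrV :
  (@lebesgue_measure R).-integrable setT (EFin \o (fun t => (oneDsqr t)^-1)).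
Proof.
have mf : measurable_fun setT (fun t : R => (oneDsqr t)^-1).
  by apply: continuous_measurable_fun; exact: continuous_oneDsqrV.
apply/integrableP; split; first exact/measurable_EFinP.
have f0 (t : R) : 0 <= (oneDsqr t)^-1.
  by rewrite invr_ge0 (le_trans ler01) ?oneDsqr_ge1.
rewrite (_ : (\int[_]_(_ in _) _)%E =
    (\int[@lebesgue_measure R]_t ((oneDsqr t)^-1)%:E)%E); last first.
  by apply: eq_integral => t _ /=; rewrite ger0_norm.
rewrite (@ge0_symfun_integralT _ (fun t => (oneDsqr t)^-1)) //.
- rewrite (_ : (\int[_]_(_ in _) _)%E = (pi / 2)%:E) ?ltry //.
  rewrite -(@integral0y_oneDsqr R); congr (integral _ _ _).
  by apply/seteqP; split => x /=; rewrite in_itv /= andbT.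
- exact: continuous_oneDsqrV.
- by move=> x; rewrite /oneDsqr /= sqrrN.
Qed.

Context {n : nat}.
Implicit Types x : 'rV[R]_n.

(** A product weight, rather than a power of 1 + |x|^2, because its integral factors over the
    coordinates and its reciprocal is a sum of monomials, which Schwartz bounds control directly. *)
Definition decay x : R := \prod_(i < n) (oneDsqr (x ord0 i))^-1.

Lemma decay_gt0 x : 0 < decay x.
Proof.
by apply: prodr_gt0 => i _; rewrite invr_gt0 (lt_le_trans ltr01) ?oneDsqr_ge1.
Qed.

Lemma measurable_decay : measurable_fun setT decay.
Proof.
apply: measurable_prod => i _.
apply: (measurableT_comp (f := fun t : R => (oneDsqr t)^-1)).
  by apply: continuous_measurable_fun; exact: continuous_oneDsqrV.
exact: measurable_coor.
Qed.

(** Lets difference quotients with steps of length at most 1 be dominated by a multiple of the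
    weight at the base point. *)
Lemma decay_shift x i (t : R) : `|t| <= 1 ->
  decay (x + t *: delta_mx ord0 i) <= 3 * decay x.
Proof.
move=> t1; rewrite /decay (bigD1 i) //= [in leRHS](bigD1 i) //= mulrA.
have -> : \prod_(j < n | j != i)
      (oneDsqr ((x + t *: delta_mx ord0 i) ord0 j))^-1 =
    \prod_(j < n | j != i) (oneDsqr (x ord0 j))^-1.
  apply: eq_bigr => j ji; rewrite !mxE eqxx (negbTE ji) /=.
  by rewrite mulr0 addr0.
apply: ler_wpM2r; first by apply: prodr_ge0 => j _; rewrite invr_ge0.
rewrite !mxE !eqxx mulr1; set y := x ord0 i.
have yp : 0 < oneDsqr y by rewrite (lt_le_trans ltr01) ?oneDsqr_ge1.
have ytp : 0 < oneDsqr (y + t) by rewrite (lt_le_trans ltr01) ?oneDsqr_ge1.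
rewrite ler_pdivlMr // mulrC ler_pdivrMr // /oneDsqr.
have : t ^+ 2 <= 1 by rewrite -(expr1n _ 2) -(real_normK (num_real t)) lerXn2r
  ?nnegrE.
(* With the constant 3, the difference of the two sides is (y + t)^2 + (y + 2t)^2 + 2(1 - t^2). *)
have := sqr_ge0 (y + 2 * t); nra.
Qed.

(* The product of the 1 + x_i ^ 2 is a sum of squared monomials. *)
Lemma le_decay (f : 'rV[R]_n -> R) :
  (forall m : 'I_n -> nat, exists M : R, forall x,
    `|\prod_(i < n) x ord0 i ^+ m i| * f x <= M) ->
  exists M : R, forall x, f x <= M * decay x.
Proof.
move=> h.
have /choice[M hM] (b : {ffun 'I_n -> bool}) : exists M : R, forall x,
    `|\prod_(i < n) x ord0 i ^+ (b i).*2| * f x <= M by exact: h.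
exists (\sum_b M b) => x; rewrite /decay prodfV ler_pdivlMr; last first.
  by apply: prodr_gt0 => i _; rewrite (lt_le_trans ltr01) ?oneDsqr_ge1.
have -> : \prod_(i < n) oneDsqr (x ord0 i) =
    \sum_(b : {ffun 'I_n -> bool}) `|\prod_(i < n) x ord0 i ^+ (b i).*2|.
  under [RHS]eq_bigr do rewrite normr_prod.
  rewrite -(bigA_distr_bigA (fun i (b : bool) => `|x ord0 i ^+ b.*2|)).
  apply: eq_bigr => i _; rewrite big_bool /= expr0 normr1 addrC.
  by rewrite ger0_norm ?sqr_ge0.
by rewrite mulrC mulr_suml; apply: ler_sum => b _; exact: hM.
Qed.

End decay.

Lemma integral_lebesgue_rowS {R : realType} (n : nat)
    (f : 'rV[R]_n.+1 -> \bar R) :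
  measurable_fun setT f -> (forall x, 0 <= f x)%E ->
  (\int[lebesgue_row n.+1]_x f x =
   \int[@lebesgue_measure R]_t \int[lebesgue_row n]_v f (row_cons (t, v)))%E.
Proof.
move=> mf f0.
have mfc : measurable_fun setT (f \o @row_cons R n).
  exact: measurableT_comp mf (@measurable_row_cons R n).
transitivity
    (\int[(@lebesgue_measure R \x lebesgue_row n)%E]_z f (row_cons z))%E.
  by rewrite -[RHS](ge0_integral_pushforward (@measurable_row_cons R n)
    (@lebesgue_measure R \x lebesgue_row n)%E measurableT mf).
by rewrite (fubini_tonelli1 (f \o @row_cons R n)) // => x; exact: f0.
Qed.

Lemma integrable_decay {R : realType} (n : nat) :
  (@lebesgue_row R n).-integrable setT (EFin \o decay).
Proof.
apply/integrableP; split; first by apply/measurable_EFinP;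
  exact: measurable_decay.
under eq_integral do rewrite /= ger0_norm ?ltW ?decay_gt0 //.
elim: n => [|n IH].
  rewrite /= integral_dirac //; last by apply/measurable_EFinP;
    exact: measurable_decay.
  by rewrite diracT mul1e ltry.
rewrite integral_lebesgue_rowS; first last.
- by move=> x; rewrite lee_fin ltW ?decay_gt0.
- by apply/measurable_EFinP; exact: measurable_decay.
have decayE (t : R) (v : 'rV[R]_n) :
    (decay (row_cons (t, v)))%:E = ((oneDsqr t)^-1%:E * (decay v)%:E)%E.
  rewrite -EFinM /decay big_ord_recl row_consE unlift_none; congr (_ * _)%:E.
  by apply: eq_bigr => j _; rewrite row_consE liftK.
have d0 (v : 'rV[R]_n) : setT v -> (0 <= (decay v)%:E)%E.
  by rewrite lee_fin ltW ?decay_gt0.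
have md : measurable_fun setT (fun v : 'rV[R]_n => (decay v)%:E).
  by apply/measurable_EFinP; exact: measurable_decay.
have o0 (t : R) : (0 <= ((oneDsqr t)^-1)%:E)%E.
  by rewrite lee_fin invr_ge0 (le_trans ler01) ?oneDsqr_ge1.
have mo : measurable_fun setT (fun t : measurableTypeR R =>
  ((oneDsqr t)^-1)%:E).
  apply/measurable_EFinP; apply: continuous_measurable_fun.
  exact: continuous_oneDsqrV.
under eq_integral => t _.
  under eq_integral do rewrite decayE.
  rewrite (ge0_integralZl _ measurableT md d0 (o0 t)) //.
  over.
have D0 : (0 <= \int[@lebesgue_row R n]_v (decay v)%:E)%E.
  by apply: integral_ge0 => v _; rewrite lee_fin ltW ?decay_gt0.
rewrite (ge0_integralZr _ measurableT mo) //.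
apply: lte_mul_pinfty => //; first by apply: integral_ge0 => t _.
exact: (integrable_fin_num measurableT integrable_oneDsqrV).
Qed.

(** * Smooth and test functions *)

Section directional.
Context {R : realType} {n : nat}.
Implicit Types (f g : 'rV[R]_n -> R[i]) (x : 'rV[R]_n) (i j : 'I_n).
Local Notation e_ i := (@delta_mx R 1 n ord0 i).
Local Notation Re := (@complex.Re R).
Local Notation Im := (@complex.Im R).

(** Reduces directional derivatives to derivatives in one real variable, where the chain rule and
    the mean value theorem are at hand. *)
Lemma is_derive_line (h : 'rV[R]_n -> R) x v d :
  is_derive (0 : R) 1 (fun t : R => h (t *: v + x)) d <-> is_derive x v h d.
Proof.
have E : 'D_1 (fun t : R => h (t *: v + x)) (0 : R) = 'D_v h x.
  rewrite /derive; set g1 := fun t => t^-1 *: _; set g2 := fun t => t^-1 *: _.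
  suff -> : g1 = g2 by [].
  apply/funext => t; rewrite /g1 /g2 /=.
  by rewrite addr0 scale0r add0r [_%:A]mulr1.
split => -[h1 h2]; constructor.
- exact: (iffRL (derivable1P h x v) h1).
- by rewrite -E.
- by move/derivable1P : h1; exact.
- by rewrite E.
Qed.

Definition is_cderive x i f (d : R[i]) : Prop :=
  is_derive x (e_ i) (fun y => Re (f y)) (Re d) /\
  is_derive x (e_ i) (fun y => Im (f y)) (Im d).

Lemma is_cderive_partial x i f :
  cderivable f x i -> is_cderive x i f (partial i f x).
Proof. by move=> [h1 h2]; split; exact: derivableP. Qed.

Lemma partialE x i f d : is_cderive x i f d -> partial i f x = d.
Proof. by move=> [[_ h1] [_ h2]]; apply: complex_eq; rewrite /= ?h1 ?h2. Qed.

Lemma is_cderive_cderivable x i f d : is_cderive x i f d -> cderivable f x i.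
Proof. by move=> [[h1 _] [h2 _]]. Qed.

Lemma is_cderiveD x i f g d e : is_cderive x i f d -> is_cderive x i g e ->
  is_cderive x i (fun y => f y + g y) (d + e).
Proof.
move=> [f1 f2] [g1 g2]; rewrite /is_cderive cReD cImD.
under [in X in X /\ _]eq_fun do rewrite cReD.
under [in X in _ /\ X]eq_fun do rewrite cImD.
by split; apply: is_deriveD.
Qed.

Lemma is_cderiveM x i f g d e : is_cderive x i f d -> is_cderive x i g e ->
  is_cderive x i (fun y => f y * g y) (d * g x + f x * e).
Proof.
move=> [f1 f2] [g1 g2].
rewrite /is_cderive cReD cImD !cReM !cImM.
under [in X in X /\ _]eq_fun do rewrite cReM.
under [in X in _ /\ X]eq_fun do rewrite cImM.
split.
  apply: (is_derive_eq (is_deriveB (is_deriveM f1 g1) (is_deriveM f2 g2))).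
  by rewrite /GRing.scale /=; ring.
apply: (is_derive_eq (is_deriveD (is_deriveM f1 g2) (is_deriveM f2 g1))).
by rewrite /GRing.scale /=; ring.
Qed.

Lemma is_cderive_cst x i (z : R[i]) : is_cderive x i (fun=> z) 0.
Proof. by split; exact: is_derive_cst. Qed.

Lemma is_cderive_coor (b : R -> R) (b' : R) (al be : R) x i j :
  is_derive (al * x ord0 j + be) 1 b b' ->
  is_cderive x i (fun y => (b (al * y ord0 j + be))%:C%C)
    (al * (i == j)%:R * b')%:C%C.
Proof.
move=> hb; split => /=; last exact: is_derive_cst.
apply/is_derive_line.
rewrite (_ : (fun t => _) =
    b \o (fun t => al * (i == j)%:R * t + (al * x ord0 j + be))); last first.
  apply/funext => t /=; rewrite !mxE eqxx /= [in LHS]eq_sym; congr b; ring.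
rewrite (_ : _ * b' = b' * (al * (i == j)%:R)); last by rewrite mulrC.
apply: is_derive1_comp; first by rewrite mulr0 add0r.
apply: is_derive_eq; rewrite addr0 /GRing.scale /=; ring.
Qed.

End directional.

(** * The smooth function exp(-1/t), flat at the origin *)

Section flat.
Context {R : realType}.
Implicit Types (p : {poly R}) (t : R).

(* The functions p(1/t) exp(-1/t), extended by 0 to t <= 0, are closed under
  differentiation. *)
Definition flat p t : R := if 0 < t then p.[t^-1] * expR (- t^-1) else 0.

(** With y = 1/t one has dy/dt = - y^2, so p(y) exp(-y) differentiates to y^2 (p(y) - p'(y))
    exp(-y). *)
Definition flat_deriv p : {poly R} := 'X^2 * (p - p^`()).

(** A quadratic bound is what makes the difference quotient at 0 tend to 0. It comes from y^(k+2) <=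
    (k+2)! exp(y), applied to each coefficient of [p] at y = 1/t. *)
Lemma flat_bound p : exists C : R, forall t, `|flat p t| <= C * t ^+ 2.
Proof.
exists (\sum_(k < size p) `|p`_k| * (k.+2)`!%:R) => t.
rewrite /flat; case: ltP => [t0|_]; last first.
  by rewrite normr0 mulr_ge0 ?sqr_ge0 // sumr_ge0 // => k _; rewrite mulr_ge0.
set y := t^-1; have y0 : 0 < y by rewrite invr_gt0.
have -> : t ^+ 2 = y ^- 2 by rewrite /y exprVn invrK.
rewrite ler_pdivlMr ?exprn_gt0 // expRN normrM.
rewrite (ger0_norm (_ : 0 <= (expR y)^-1)) ?invr_ge0 ?expR_ge0 //.
rewrite mulrAC ler_pdivrMr ?expR_gt0 // horner_coef mulr_suml.
apply: (@le_trans _ _ (\sum_(k < size p) `|p`_k| * y ^+ k.+2)).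
  rewrite (le_trans (ler_wpM2r _ (ler_norm_sum _ _ _))) ?sqr_ge0 //.
  rewrite mulr_suml; apply: ler_sum => k _.
  by rewrite normrM (ger0_norm (exprn_ge0 _ (ltW y0))) -mulrA -exprD addn2.
apply: ler_sum => k _; rewrite -mulrA ler_wpM2l //.
rewrite mulrC -ler_pdivrMr ?ltr0n ?fact_gt0 //.
by apply: le_trans (expR_ge1Dxn k.+1 (ltW y0)); rewrite lerDr.
Qed.

Lemma is_derive_flat p t : is_derive t 1 (flat p) (flat (flat_deriv p) t).
Proof.
have [t0|t0|->] := ltgtP t 0.
- rewrite [flat _ t]/flat ltNge ltW //=.
  apply: near_eq_is_derive (is_derive_cst 0 t 1).
  near=> s; rewrite /flat ltNge ltW //=.
  by near: s; exact: lt_nbhsl.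
- have tn0 : t != 0 by rewrite gt_eqF.
  rewrite [flat _ t]/flat t0.
  apply: (near_eq_is_derive (f := fun s : R => p.[s^-1] * expR (- s^-1))).
    near=> s; rewrite /flat ifT //.
    by near: s; exact: lt_nbhsr.
  have dV : is_derive t 1 (fun s : R => s^-1) (- t ^- 2).
    rewrite -[_ ^- 2]mulr1 -mulNr.
    exact: (is_deriveV (f := id) tn0).
  have dp : is_derive t 1 (fun s => p.[s^-1]) (p^`().[t^-1] * - t ^- 2).
    exact: (is_derive1_comp (f := horner p) _ dV).
  have de : is_derive t 1 (fun s => expR (- s^-1)) (expR (- t^-1) * t ^- 2).
    rewrite -[X in _ * X]opprK.
    by apply: (is_derive1_comp (f := expR)); exact: is_deriveN.
  apply: (is_derive_eq (is_deriveM dp de)).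
  rewrite /flat_deriv !(hornerE, hornerM, hornerXn) /GRing.scale /= exprVn.
  by ring.
- rewrite [flat _ 0]/flat ltxx; have [C hC] := flat_bound p.
  (* At the junction t = 0 the quotient is at most C |h| in absolute value, so the derivative is 0,
     the value that [flat] takes there for every polynomial. *)
  have lim0 : (fun h => h^-1 *: ((flat p \o shift 0) (h *: 1) - flat p 0))
      @ (0 : R)^' --> (0 : R).
    have B : (fun h : R => C * `|h|) @ (0 : R)^' --> (0 : R).
      have := iffLR (continuous_withinNx (fun h : R => C * `|h|) 0).
      rewrite normr0 mulr0; apply; apply: cvgM; first exact: cvg_cst.
      exact: norm_continuous.
    apply/norm_cvg0P; apply: (squeeze_cvgr _ (cvg_cst 0) B).
    near=> h; rewrite normr_ge0 /=.
    have h0 : h != 0 by near: h; exact: nbhs_dnbhs_neq.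
    rewrite addr0 [h *: 1]mulr1 /(flat _ 0) ltxx subr0.
    rewrite normrM normfV mulrC ler_pdivrMr ?normr_gt0 // -mulrA -expr2.
    by rewrite real_normK ?num_real.
  by constructor; [apply/cvg_ex; exists 0|exact: cvg_lim].
Unshelve. all: by end_near. Qed.

Lemma continuous_flat p : continuous (flat p).
Proof.
by move=> t; apply/differentiable_continuous/derivable1_diffP;
  have [] := is_derive_flat p t.
Qed.

End flat.

(** * Smooth functions: products, characters, and flat functions of a coordinate *)

Section smoothness.
Context {R : realType} {n : nat}.
Implicit Types (f g phi : 'rV[R]_n -> R[i]) (x xi : 'rV[R]_n) (i j : 'I_n)
  (k : nat).

(** Smoothness by recursion on the order, with the first derivative taken innermost. By the Leibniz
    rule a first derivative of a product is a sum of products smooth to one order less, so closure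
    under products follows by induction on [k]. *)
Fixpoint ksmooth k f : Prop := continuous f /\
  if k is k'.+1
  then forall i, (forall x, cderivable f x i) /\ ksmooth k' (partial i f)
  else True.

Lemma ksmooth_continuous k f : ksmooth k f -> continuous f.
Proof. by case: k => [|k] []. Qed.

Lemma ksmoothW k f : ksmooth k.+1 f -> ksmooth k f.
Proof.
elim: k f => [|k IH] f [cf hf]; split => // i.
have [h1 h2] := hf i; split => //; exact: IH.
Qed.

Lemma continuous_cfunD f g : continuous f -> continuous g ->
  continuous (fun x => f x + g x).
Proof.
move=> cf cg x; apply/ccontinuous_ReIm.
have /ccontinuous_ReIm[f1 f2] := cf x; have /ccontinuous_ReIm[g1 g2] := cg x.
split; rewrite /prop_for /continuous_at ?cReD ?cImD.
  by under eq_fun do rewrite cReD; exact: (cvgD f1 g1).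
by under eq_fun do rewrite cImD; exact: (cvgD f2 g2).
Qed.

Lemma continuous_cfunM f g : continuous f -> continuous g ->
  continuous (fun x => f x * g x).
Proof.
move=> cf cg x; apply/ccontinuous_ReIm.
have /ccontinuous_ReIm[f1 f2] := cf x; have /ccontinuous_ReIm[g1 g2] := cg x.
split; rewrite /prop_for /continuous_at ?cReM ?cImM.
  by under eq_fun do rewrite cReM;
    exact: (cvgB (cvgM f1 g1) (cvgM f2 g2)).
by under eq_fun do rewrite cImM;
    exact: (cvgD (cvgM f1 g2) (cvgM f2 g1)).
Qed.

Lemma ksmoothD k f g : ksmooth k f -> ksmooth k g ->
  ksmooth k (fun x => f x + g x).
Proof.
elim: k f g => [|k IH] f g [cf hf] [cg hg]; split; try exact: continuous_cfunD.
  by [].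
move=> i; have [df kf] := hf i; have [dg kg] := hg i.
have D x := is_cderiveD (is_cderive_partial (df x)) (is_cderive_partial (dg x)).
split=> [x|]; first exact: is_cderive_cderivable (D x).
rewrite (_ : partial i _ = fun x => partial i f x + partial i g x).
  exact: IH.
by apply/funext => x; exact: partialE (D x).
Qed.

Lemma ksmoothM k f g : ksmooth k f -> ksmooth k g ->
  ksmooth k (fun x => f x * g x).
Proof.
elim: k f g => [|k IH] f g hf0 hg0; have cf := ksmooth_continuous hf0;
  have cg := ksmooth_continuous hg0; split; try exact: continuous_cfunM.
  by [].
have [_ hf] := hf0; have [_ hg] := hg0.
move=> i; have [df kf] := hf i; have [dg kg] := hg i.
have D x := is_cderiveM (is_cderive_partial (df x)) (is_cderive_partial (dg x)).
split=> [x|]; first exact: is_cderive_cderivable (D x).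
rewrite (_ : partial i _ = fun x => partial i f x * g x + f x * partial i g x).
  by apply: ksmoothD; apply: IH => //; exact: ksmoothW.
by apply/funext => x; exact: partialE (D x).
Qed.

Lemma ksmooth_cst k (z : R[i]) : ksmooth k (fun=> z).
Proof.
elim: k z => [|k IH] z; (split; first exact: cst_continuous) => // i.
split=> [x|]; first exact: is_cderive_cderivable (is_cderive_cst x i z).
rewrite (_ : partial i _ = fun=> 0); first exact: IH.
by apply/funext => x; exact: partialE (is_cderive_cst x i z).
Qed.

Lemma smoothP f : smooth f <-> forall k, ksmooth k f.
Proof.
split=> [sf k|kf s].
  elim: k f sf => [|k IH] f sf; (split; first exact: (sf [::]).1) => // i.
  split; first by move=> x; exact: (sf [::]).2.
  (* [partials] applies the last index of the list first, so appending [i] at the end amounts to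
     starting from [partial i f]. *)
  by apply: IH => s; have := sf (rcons s i); rewrite /partials foldr_rcons.
elim/last_ind: s f kf => [|s i IH] f kf.
  rewrite /partials /=; split; first exact: ksmooth_continuous (kf 0).
  by move=> i x; have [_ /(_ i)[]] := kf 1.
rewrite /partials foldr_rcons; apply: IH => k.
by have [_ /(_ i)[]] := kf k.+1.
Qed.

Lemma smoothM f g : smooth f -> smooth g -> smooth (fun x => f x * g x).
Proof.
by move=> /smoothP sf /smoothP sg; apply/smoothP => k; exact: ksmoothM.
Qed.

Lemma smooth_cst (z : R[i]) : smooth (fun _ : 'rV[R]_n => z).
Proof. by apply/smoothP => k; exact: ksmooth_cst. Qed.

Lemma smooth_prod (I : Type) (r : seq I) (F : I -> 'rV[R]_n -> R[i]) :
  (forall a, smooth (F a)) -> smooth (fun x => \prod_(a <- r) F a x).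
Proof.
move=> sF; elim: r => [|a r IH].
  by under eq_fun do rewrite big_nil; exact: smooth_cst.
by under eq_fun do rewrite big_cons; exact: smoothM.
Qed.

Lemma smooth_continuous f : smooth f -> continuous f.
Proof. by move=> /(_ [::])[]. Qed.

Lemma smooth_partial i f : smooth f -> smooth (partial i f).
Proof.
move=> sf s; have := sf (rcons s i); by rewrite /partials foldr_rcons.
Qed.

Lemma continuous_affine_coor (al be : R) j :
  continuous (fun x : 'rV[R]_n => al * x ord0 j + be).
Proof.
move=> x; apply: (@continuousD _ _ _ (fun x : 'rV[R]_n => al * x ord0 j)
  (cst be)).
  apply: (@continuousM _ _ (cst al) (fun x : 'rV[R]_n => x ord0 j)).
    exact: cst_continuous.
  exact: coord_continuous.
exact: cst_continuous.
Qed.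

Lemma smooth_flat (p : {poly R}) (al be : R) j :
  smooth (fun x : 'rV[R]_n => (flat p (al * x ord0 j + be))%:C%C).
Proof.
apply/smoothP => k; elim: k p => [|k IH] p; split => //.
1,2: move=> x; apply/ccontinuous_ReIm; split; last exact: cst_continuous;
  apply: (continuous_comp (f := fun x => al * x ord0 j + be) (g := flat p));
  [exact: continuous_affine_coor | exact: continuous_flat].
move=> i.
have D x := @is_cderive_coor _ _ _ _ al be x i j (is_derive_flat p _).
split=> [x|]; first exact: is_cderive_cderivable (D x).
rewrite (_ : partial i _ = fun x => (al * (i == j)%:R)%:C%C *
    (flat (flat_deriv p) (al * x ord0 j + be))%:C%C).
  by apply: ksmoothM => //; exact: ksmooth_cst.
by apply/funext => x; rewrite (partialE (D x)) rmorphM.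
Qed.

Lemma dotC x xi : dot x xi = dot xi x.
Proof. by apply: eq_bigr => i _; rewrite mulrC. Qed.

Lemma dotDl x y xi : dot (x + y) xi = dot x xi + dot y xi.
Proof. by rewrite -big_split; apply: eq_bigr => i _; rewrite mxE mulrDl. Qed.

Lemma dotZl (t : R) x xi : dot (t *: x) xi = t * dot x xi.
Proof. by rewrite mulr_sumr; apply: eq_bigr => i _; rewrite mxE mulrA. Qed.

Lemma dotNl x xi : dot (- x) xi = - dot x xi.
Proof. by rewrite -scaleN1r dotZl mulN1r. Qed.

Lemma dotDr x xi y : dot x (xi + y) = dot x xi + dot x y.
Proof. by rewrite dotC dotDl !(dotC x). Qed.

Lemma dotZr (t : R) x xi : dot x (t *: xi) = t * dot x xi.
Proof. by rewrite dotC dotZl dotC. Qed.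

Lemma dotNr x xi : dot x (- xi) = - dot x xi.
Proof. by rewrite dotC dotNl dotC. Qed.

Lemma dot0r x : dot x 0 = 0.
Proof. by apply: big1 => i _; rewrite mxE mulr0. Qed.

Lemma dot_delta i xi : dot (delta_mx ord0 i) xi = xi ord0 i.
Proof.
rewrite /dot (bigD1 i) //= mxE !eqxx mul1r big1 ?addr0 // => j ji.
by rewrite mxE (negbTE ji) andbF mul0r.
Qed.

Lemma continuous_dot xi : continuous (dot^~ xi : 'rV[R]_n -> R).
Proof.
rewrite /dot; elim: (index_enum _) => [|i r IH].
  by under eq_fun do rewrite big_nil; exact: cst_continuous.
under eq_fun do rewrite big_cons mulrC -[_ * _]addr0.
by move=> x; exact: (continuousD (@continuous_affine_coor _ 0 i x) (IH x)).
Qed.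

Lemma is_cderive_expi x xi i : is_cderive x i (fun y => expi (dot y xi))
  ('i%C * (xi ord0 i)%:C%C * expi (dot x xi)).
Proof.
have dE : is_derive (0 : R) 1 (fun t => xi ord0 i * t + dot x xi) (xi ord0 i).
  by apply: is_derive_eq; rewrite addr0 /GRing.scale /= mulr1.
split; apply/is_derive_line.
  rewrite (_ : (fun t => _) = cos \o (fun t => xi ord0 i * t + dot x xi)).
    rewrite (_ : complex.Re _ = - sin (dot x xi) * xi ord0 i);
      last by rewrite /=; ring.
    apply: is_derive1_comp; rewrite mulr0 add0r; exact: is_derive_cos.
  by apply/funext => t /=; rewrite dotDl dotZl dot_delta mulrC.
rewrite (_ : (fun t => _) = sin \o (fun t => xi ord0 i * t + dot x xi)).
  rewrite (_ : complex.Im _ = cos (dot x xi) * xi ord0 i); last by rewrite /=;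
    ring.
  apply: is_derive1_comp; rewrite mulr0 add0r; exact: is_derive_sin.
by apply/funext => t /=; rewrite dotDl dotZl dot_delta mulrC.
Qed.

Lemma continuous_expi (t : 'rV[R]_n -> R) : continuous t ->
  continuous (fun x => expi (t x)).
Proof.
move=> ct x; apply/ccontinuous_ReIm; split => /=.
  by apply: (continuous_comp (g := @cos R)); [exact: ct|exact: continuous_cos].
by apply: (continuous_comp (g := @sin R)); [exact: ct|exact: continuous_sin].
Qed.

Lemma smooth_expi xi : smooth (fun x => expi (dot x xi)).
Proof.
apply/smoothP => k; elim: k => [|k IH]; split => //;
  try (apply: continuous_expi; exact: continuous_dot).
move=> i; have D x := is_cderive_expi x xi i.
split=> [x|]; first exact: is_cderive_cderivable (D x).
rewrite (_ : partial i _ = fun x => 'i%C * (xi ord0 i)%:C%C * expi (dot x xi)).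
  by apply: ksmoothM => //; exact: ksmooth_cst.
by apply/funext => x; rewrite (partialE (D x)).
Qed.

End smoothness.

(** * Test functions and product bumps *)

Section test_functions.
Context {R : realType} {n : nat}.
Implicit Types (f g phi : 'rV[R]_n -> R[i]) (x xi : 'rV[R]_n) (i j : 'I_n)
  (k : nat).
Implicit Types (a b : 'I_n -> R).

Lemma test_functionM f phi : smooth f -> test_function phi ->
  test_function (fun x => f x * phi x).
Proof.
move=> sf [sp cp]; split; first exact: smoothM.
apply: subclosed_compact cp _; first exact: closed_closure.
by apply: closure_subset => x /=; rewrite mulf_eq0 negb_or => /andP[].
Qed.

Lemma partials_support (K : set 'rV[R]_n) f (s : seq 'I_n) : closed K ->
  (forall x, ~ K x -> f x = 0) -> forall x, ~ K x -> partials s f x = 0.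
Proof.
move=> cK f0; elim: s => //= i s IH x nKx; apply: partialE.
have nK : \forall y \near x, 0 = partials s f y.
  have : nbhs x (~` K) by apply: open_nbhs_nbhs; split => //;
    exact: closed_openC.
  by apply: filterS => y /= nKy; rewrite IH.
split; apply: (near_eq_is_derive (f := cst 0)); try exact: is_derive_cst.
  by apply: filterS nK => y <-.
by apply: filterS nK => y <-.
Qed.

Lemma continuous_monomial (m : 'I_n -> nat) :
  continuous (fun x : 'rV[R]_n => \prod_(i < n) x ord0 i ^+ m i).
Proof.
apply: continuous_big => [|i _ x]; first exact: mul_continuous.
apply: (continuous_comp (f := fun x : 'rV[R]_n => x ord0 i) (g := fun t : R =>
  t ^+ m i)).
  exact: coord_continuous.
exact: exprn_continuous.
Qed.

Lemma test_function_schwartz phi : test_function phi -> schwartz phi.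
Proof.
move=> [sp cp]; split => // s m.
pose h x := `|\prod_(i < n) x ord0 i ^+ m i| * cabs (partials s phi x).
have ch : continuous h.
  have c1 : continuous (fun x : 'rV[R]_n => `|\prod_(i < n) x ord0 i ^+ m i|).
    move=> x; apply: (continuous_comp (g := fun t : R => `|t|)
      (f := fun x : 'rV[R]_n => \prod_(i < n) x ord0 i ^+ m i)).
      exact: continuous_monomial.
    exact: norm_continuous.
  have c2 := continuous_cabs (sp s).1.
  by move=> x; exact: (continuousM (c1 x) (c2 x)).
have /compact_bounded[M [_ hM]] := continuous_compact (continuous_subspaceT ch)
  cp.
(* Boundedness of the image of the support provides bounds strictly above [M] only, hence [M + 1];
   the 0 serves the points outside the support, where all derivatives vanish. *)
exists (Num.max 0 (M + 1)) => x.
have [Kx|nKx] := pselect (closure [set x | phi x != 0] x).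
  rewrite le_max; apply/orP; right.
  apply: le_trans (ler_norm _) _; apply: (hM (M + 1)); first by rewrite ltrDl.
  by exists x.
rewrite (partials_support (K := closure [set x | phi x != 0])) //.
- by rewrite cabs0 mulr0 le_max lexx.
- exact: closed_closure.
- by move=> y nKy; apply/eqP/negPn/negP => hy; apply/nKy/subset_closure.
Qed.

Lemma flat1_ge0 (t : R) : 0 <= flat 1 t.
Proof.
by rewrite /flat; case: ifP => // _; rewrite hornerC mul1r expR_ge0.
Qed.

Lemma flat1_gt0 (t : R) : 0 < t -> 0 < flat 1 t.
Proof. by rewrite /flat => ->; rewrite hornerC mul1r expR_gt0. Qed.

Lemma flat1_le1 (t : R) : flat 1 t <= 1.
Proof.
rewrite /flat; case: ifP => // t0.
by rewrite hornerC mul1r -expR0 ler_expR oppr_le0 invr_ge0 ltW.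
Qed.

(** The parameter [m] sharpens the bump: inside the box a factor at distance s from a face is
    exp(-1/(m s)), which tends to 1 as m grows, while outside the box the product is 0. *)
Definition box_bump a b (m : R) x : R := \prod_(i < n)
  (flat 1 (m * (x ord0 i - a i)) * flat 1 (m * (b i - x ord0 i))).

Lemma box_bump_ge0 a b (m : R) x : 0 <= box_bump a b m x.
Proof. by apply: prodr_ge0 => i _; rewrite mulr_ge0 ?flat1_ge0. Qed.

Lemma box_bump_le1 a b (m : R) x : box_bump a b m x <= 1.
Proof.
by apply: prodr_ile1 => i _; rewrite mulr_ge0 ?flat1_ge0 //= mulr_ile1
  ?flat1_ge0 ?flat1_le1.
Qed.

Lemma box_bump_gt0 a b (m : R) x : 0 < m -> open_box a b x ->
  0 < box_bump a b m x.
Proof.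
move=> m0 /open_boxP h; apply: prodr_gt0 => i _; have /andP[h1 h2] := h i.
by rewrite mulr_gt0 // flat1_gt0 // mulr_gt0 // subr_gt0.
Qed.

Lemma box_bump_eq0 a b (m : R) x : 0 < m -> ~ open_box a b x ->
  box_bump a b m x = 0.
Proof.
move=> m0 nx; apply/eqP; rewrite prodf_seq_eq0; apply/hasP.
have /existsNP[i hi] : ~ forall i, a i < x ord0 i < b i by move/open_boxP.
exists i; first exact: mem_index_enum.
rewrite /= mulf_eq0 /flat !pmulr_rgt0 // !subr_gt0.
by move/negP : hi; rewrite negb_and => /orP[] /negbTE ->; rewrite eqxx ?orbT.
Qed.

Lemma smooth_box_bump a b (m : R) : smooth (fun x => (box_bump a b m x)%:C%C).
Proof.
rewrite (_ : (fun x => _) = fun x => \prod_(i < n)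
    ((flat 1 (m * x ord0 i + - (m * a i)))%:C%C *
     (flat 1 (- m * x ord0 i + m * b i))%:C%C)); last first.
  apply/funext => x; rewrite /box_bump rmorph_prod; apply: eq_bigr => i _.
  by rewrite rmorphM /= !mulrBr [m * b i - _]addrC mulNr.
by apply: smooth_prod => i; apply: smoothM; exact: smooth_flat.
Qed.

Lemma test_function_box_bump a b (m : R) : 0 < m ->
  test_function (fun x => (box_bump a b m x)%:C%C).
Proof.
move=> m0; split; first exact: smooth_box_bump.
have cK : compact [set x : 'rV[R]_n | forall i, `[a i, b i]%classic (x ord0 i)].
  apply: (rV_compact (A := fun i => `[a i, b i]%classic)) => i.
  exact: segment_compact.
apply: (subclosed_compact _ cK); first exact: closed_closure.
have /closure_id -> := compact_closed (@norm_hausdorff _ _) cK.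
apply: closure_subset => x /= hx i; rewrite in_itv /=.
have /open_boxP /(_ i) /andP[h1 h2] : open_box a b x.
  by apply: contrapT => /(box_bump_eq0 m0) h; move: hx; rewrite h eqxx.
by rewrite !ltW.
Qed.

Lemma box_bump_cvg a b x :
  box_bump a b k.+1%:R x @[k --> \oo] --> (\1_(open_box a b) x : R).
Proof.
have [xB|nxB] := pselect (open_box a b x); last first.
  rewrite indicE memNset //; apply: cvg_near_cst; apply: nearW => k.
  by rewrite box_bump_eq0.
rewrite indicE mem_set //.
(* Inside the box the exponents add up, so the bump equals exp(-S/(k+1)) with [S] independent of
   [k]. *)
pose S := \sum_(i < n) ((x ord0 i - a i)^-1 + (b i - x ord0 i)^-1).
have E k : box_bump a b k.+1%:R x = expR (- (S * k.+1%:R^-1)).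
  rewrite -mulNr -sumrN mulr_suml expR_sum; apply: eq_bigr => i _.
  have /open_boxP /(_ i)/andP[h1 h2] := xB.
  rewrite /flat !pmulr_rgt0 ?ltr0n // !subr_gt0 h1 h2 !hornerC !mul1r -expRD.
  by congr expR; rewrite !invfM; ring.
under eq_fun do rewrite E.
have h : - (S * k.+1%:R^-1) @[k --> \oo] --> (0 : R).
  rewrite -oppr0 -(mulr0 S); apply: cvgN; apply: cvgM; first exact: cvg_cst.
  exact: cvg_harmonic.
by have := @continuous_cvg _ _ _ _ _ _ expR _ (@continuous_expR R 0) h;
  rewrite expR0; apply.
Qed.

Lemma exists_test_function x : exists chi : 'rV[R]_n -> R,
  [/\ test_function (fun y => (chi y)%:C%C), forall y, 0 <= chi y & 0 < chi x].
Proof.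
exists (box_bump (fun i => x ord0 i - 1) (fun i => x ord0 i + 1) 1); split.
- exact: test_function_box_bump.
- exact: box_bump_ge0.
- apply: box_bump_gt0 => //; apply/open_boxP => i.
  by rewrite ltrBlDr ltrDl ltr01.
Qed.

End test_functions.

(** * Functions that vanish almost everywhere *)

Section ae_zero.
Context {R : realType} {n : nat}.
Implicit Types (f g h phi : 'rV[R]_n -> R[i]).
Local Notation mu := (@lebesgue_row R n).

Lemma ae_eq_Rintegral (f g : 'rV[R]_n -> R) :
  measurable_fun setT f -> measurable_fun setT g ->
  {ae mu, forall x, f x = g x} -> \int[mu]_x f x = \int[mu]_x g x.
Proof.
move=> mf mg fg; rewrite /Rintegral; congr fine.
apply: ae_eq_integral => //; try exact/measurable_EFinP.
by apply: filterS fg => x fgx _; rewrite fgx.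
Qed.

Lemma ae_cintegral0 f : cmeasurable f -> {ae mu, forall x, f x = 0} ->
  cintegral f = 0.
Proof.
move=> [m1 m2] f0; apply: complex_eq; rewrite /=.
  rewrite (@ae_eq_Rintegral _ (cst 0)) //;
    first by rewrite /Rintegral integral0.
  by apply: filterS f0 => x ->.
rewrite (@ae_eq_Rintegral _ (cst 0)) //; first by rewrite /Rintegral integral0.
by apply: filterS f0 => x ->.
Qed.

Lemma ae_L1norm f g : cmeasurable f -> cmeasurable g ->
  {ae mu, forall x, f x = g x} -> L1norm f = L1norm g.
Proof.
move=> mf mg fg; apply: ae_eq_Rintegral; try exact: measurable_cabs.
by apply: filterS fg => x ->.
Qed.

Lemma continuous_cae0 f : continuous f -> {ae mu, forall x, f x = 0} ->
  forall x, f x = 0.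
Proof.
move=> cf f0 x; apply/eqP; rewrite -cabs_eq0; apply/eqP.
apply: (continuous_ae0 (f := fun x => cabs (f x)));
  first exact: continuous_cabs.
by apply: filterS f0 => y fy _ /=; rewrite fy cabs0.
Qed.

Lemma L1norm_eq0_ae f : cintegrable f -> L1norm f = 0 ->
  {ae mu, forall x, f x = 0}.
Proof.
move=> fi; have ci := integrable_cabs fi; rewrite /L1norm /Rintegral => h.
have : (\int[mu]_x `|(cabs (f x))%:E| = 0)%E.
  rewrite (eq_integral (fun x => (cabs (f x))%:E)); last first.
    by move=> x _ /=; rewrite ger0_norm ?cabs_ge0.
  by rewrite -(fineK (integrable_fin_num measurableT ci)) h.
move/(ae_eq_integral_abs mu measurableT (measurable_int _ ci)).
apply: filterS => x /(_ I) [] /eqP; rewrite cabs_eq0; exact/eqP.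
Qed.

(** As [k] grows the bumps tend to the indicator of the box and stay below 1, so dominated
    convergence under |h| gives zero integrals over all open boxes. *)
Lemma Rintegral_test_ae0 (h : 'rV[R]_n -> R) :
  mu.-integrable setT (EFin \o h) ->
  (forall a b k, \int[mu]_x (h x * box_bump a b k.+1%:R x) = 0) ->
  ae_eq mu setT (EFin \o h) (cst 0%E).
Proof.
move=> hi h0; have mh : measurable_fun setT h.
  by have /measurable_EFinP := measurable_int _ hi.
apply: Rintegral_open_box_ae0 => // a b.
have mb k : measurable_fun setT (box_bump a b k.+1%:R).
  by have [] := continuous_cmeasurable (smooth_continuous (smooth_box_bump a b
    k.+1%:R)).
have : (\int[mu]_x (h x * box_bump a b k.+1%:R x)) @[k --> \oo] -->
    \int[mu]_x (h x * \1_(open_box a b) x).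
  apply: (Rintegral_dominated_cvg _ _ (integrable_norm hi)).
  - by move=> k; exact: measurable_funM.
  - apply: measurable_funM => //; apply: measurable_indic.
    exact: measurable_open_box.
  - by move=> x; apply: cvgM; [exact: cvg_cst|exact: box_bump_cvg].
  - move=> k x; rewrite normrM ler_piMr //.
    by rewrite ger0_norm ?box_bump_ge0 ?box_bump_le1.
under eq_fun do rewrite h0.
move=> h1; rewrite Rintegral_mkcond patch_indic.
exact: (cvg_unique _ h1 (cvg_cst _)).
Qed.

(** The fundamental lemma of the calculus of variations for integrable functions. The bumps are
    real, so real and imaginary parts are tested separately. *)
Lemma test_ae0 h : cintegrable h ->
  (forall phi, test_function phi -> cintegral (fun x => h x * phi x) = 0) ->
  {ae mu, forall x, h x = 0}.
Proof.
move=> [h1 h2] h0.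
have bumpE a b k : cintegral (fun x => h x * (box_bump a b k.+1%:R x)%:C%C) = 0.
  by apply: h0; exact: test_function_box_bump.
have ae1 : ae_eq mu setT (EFin \o (fun x => complex.Re (h x))) (cst 0%E).
  apply: Rintegral_test_ae0 => // a b k.
  have := congr1 (@complex.Re R) (bumpE a b k); rewrite /= => <-.
  by apply: eq_Rintegral => x _; rewrite cReM /= mulr0 subr0.
have ae2 : ae_eq mu setT (EFin \o (fun x => complex.Im (h x))) (cst 0%E).
  apply: Rintegral_test_ae0 => // a b k.
  have := congr1 (@complex.Im R) (bumpE a b k); rewrite /= => <-.
  by apply: eq_Rintegral => x _; rewrite cImM /= mulr0 add0r.
apply: filterS2 ae1 ae2 => x /(_ I) [h1x] /(_ I) [h2x].
exact: complex_eq.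
Qed.

End ae_zero.

(** * Fourier transform of integrable and of Schwartz functions *)

Section inverse_fourier.
Context {R : realType} {n : nat}.
Implicit Types (f g h phi : 'rV[R]_n -> R[i]) (x y xi : 'rV[R]_n) (i : 'I_n).
Local Notation mu := (@lebesgue_row R n).

(* No factor (2 pi)^-n, so that [ift] and [fourier] differ by a reflection. *)
Definition ift g x : R[i] := cintegral (fun xi => expi (dot x xi) * g xi).

Lemma fourier_ift f xi : fourier f xi = ift f (- xi).
Proof.
by rewrite /fourier /ift; under eq_fun do rewrite dotC -dotNl.
Qed.

Lemma measurable_dot_pair :
  measurable_fun setT (fun p : 'rV[R]_n * 'rV[R]_n => dot p.1 p.2).
Proof.
apply: measurable_sum => i; apply: measurable_funM.
  exact: (measurableT_comp (measurable_coor i) measurable_fst).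
exact: (measurableT_comp (measurable_coor i) measurable_snd).
Qed.

Lemma measurable_dot x : measurable_fun setT (dot x : 'rV[R]_n -> R).
Proof. exact: measurableT_comp measurable_dot_pair (measurable_pair1 x). Qed.

Lemma cintegrable_expi x g : cintegrable g ->
  cintegrable (fun xi => expi (dot x xi) * g xi).
Proof.
apply: (@cintegrableMl _ _ 1); first exact: cmeasurable_expi (measurable_dot x).
by move=> xi; rewrite cabs_expi.
Qed.

Lemma L1norm_expi x g : L1norm (fun xi => expi (dot x xi) * g xi) = L1norm g.
Proof. by apply: eq_Rintegral => xi _; rewrite cabsM cabs_expi mul1r. Qed.

Lemma ler_cabs_ift g x : cintegrable g -> cabs (ift g x) <= 2 * L1norm g.
Proof.
by move=> gi; rewrite -(L1norm_expi x) ler_cabs_cintegral //;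
  exact: cintegrable_expi.
Qed.

Lemma ift_ae0 g x : cintegrable g -> {ae mu, forall xi, g xi = 0} ->
  ift g x = 0.
Proof.
move=> gi g0; apply: ae_cintegral0.
  exact: cintegrable_measurable (cintegrable_expi x gi).
by apply: filterS g0 => xi ->; rewrite mulr0.
Qed.

Lemma iftD f g x : cintegrable f -> cintegrable g ->
  ift (fun xi => f xi + g xi) x = ift f x + ift g x.
Proof.
move=> fi gi; rewrite /ift; under eq_fun do rewrite mulrDr.
by rewrite cintegralD //; exact: cintegrable_expi.
Qed.

Lemma iftZ (z : R[i]) g x : cintegrable g ->
  ift (fun xi => z * g xi) x = z * ift g x.
Proof.
move=> gi; rewrite /ift; under eq_fun do rewrite mulrCA.
by rewrite cintegralZ //; exact: cintegrable_expi.
Qed.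

Lemma ccvg_expi (t : nat -> R) (s : R) : t @ \oo --> s ->
  ccvg (fun k => expi (t k)) (expi s).
Proof.
move=> ts; apply/ccvg_ReIm; split => /=.
  by have := @continuous_cvg _ _ _ _ _ _ cos _ (@continuous_cos R s) ts; apply.
by have := @continuous_cvg _ _ _ _ _ _ sin _ (@continuous_sin R s) ts; apply.
Qed.

Lemma cvg_dotl (u : nat -> 'rV[R]_n) x xi :
  (forall i, u k ord0 i @[k --> \oo] --> x ord0 i) ->
  dot (u k) xi @[k --> \oo] --> dot x xi.
Proof.
move=> ux; apply: cvg_big => [|i _]; first exact: add_continuous.
by apply: cvgM; [exact: ux|exact: cvg_cst].
Qed.

(** Dominated convergence speaks of sequences, hence a sequential criterion. If it failed, choosing
    a bad point at coordinate distance below 1/(k+1) for each [k] would give a contradicting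
    sequence. *)
Lemma seq_continuous f x :
  (forall u : nat -> 'rV[R]_n, (forall i, u k ord0 i @[k --> \oo] -->
    x ord0 i) ->
    ccvg (fun k => f (u k)) (f x)) -> {for x, continuous f}.
Proof.
move=> h; apply/ccontinuousP => e e0; apply: contrapT => nf.
have /choice[u hu] (k : nat) : exists y : 'rV[R]_n,
    (forall i, `|x ord0 i - y ord0 i| < k.+1%:R^-1) /\ e <= cabs (f y - f x).
  apply: contrapT => /forallNP hk; apply: nf; apply/nbhs_open_box.
  exists k.+1%:R^-1 => // y /open_boxP hy; rewrite /= ltNge; apply/negP => ef.
  by apply: (hk y); split => // i; rewrite ltr_distlC hy.
have := h u _; rewrite /ccvg => /(_ _)/cvgrPdist_lt -/(_ _ e e0)[].
  move=> i; apply/cvgrPdist_lt => d d0; have /cvgrPdist_lt := @cvg_harmonic R.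
  move=> /(_ _ d0); apply: filterS => k; rewrite sub0r normrN /= ger0_norm //.
  by apply: lt_trans; exact: (hu k).1.
move=> N _ /(_ N (leqnn _)); rewrite sub0r normrN ger0_norm ?cabs_ge0 //.
by rewrite ltNge (hu N).2.
Qed.

Lemma ccontinuous_seq f x (u : nat -> 'rV[R]_n) : {for x, continuous f} ->
  (forall i, u k ord0 i @[k --> \oo] --> x ord0 i) ->
    ccvg (fun k => f (u k)) (f x).
Proof.
move=> /ccontinuousP fx ux; apply/cvgrPdist_lt => e e0.
have /nbhs_open_box[d d0 hd] := fx _ e0.
have : \forall k \near \oo, forall i, `|x ord0 i - u k ord0 i| < d.
  apply: filter_forall => i; have /cvgrPdist_lt := ux i; exact.
apply: filterS => k hk; rewrite sub0r normrN ger0_norm ?cabs_ge0 //.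
by apply: hd; apply/open_boxP => i; rewrite -ltr_distlC.
Qed.

Lemma continuous_ift g : cintegrable g -> continuous (ift g).
Proof.
move=> gi x; apply: seq_continuous => u ux;
  have mg := cintegrable_measurable gi.
apply: (cintegral_ccvg (g := fun xi => cabs (g xi))).
- by move=> k; exact: cintegrable_measurable (cintegrable_expi (u k) gi).
- exact: cintegrable_measurable (cintegrable_expi x gi).
- exact: integrable_cabs.
- move=> xi; apply: ccvgM; last exact: ccvg_cst.
  by apply: ccvg_expi; exact: cvg_dotl.
- by move=> k xi; rewrite cabsM cabs_expi mul1r.
Qed.

(** The multiplication formula: the kernel exp(i x.xi) is symmetric and of modulus 1, so Fubini
    applies under |g| |f|. *)
Lemma cintegral_iftC f g : cintegrable f -> cintegrable g ->
  cintegral (fun x => ift f x * g x) = cintegral (fun xi => f xi * ift g xi).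
Proof.
move=> fi gi.
have mf := cintegrable_measurable fi; have mg := cintegrable_measurable gi.
pose F (p : 'rV[R]_n * 'rV[R]_n) := expi (dot p.1 p.2) * g p.1 * f p.2.
have mF : cmeasurable F.
  apply: cmeasurableM; last exact: (cmeasurable_comp mf measurable_snd).
  apply: cmeasurableM; last exact: (cmeasurable_comp mg measurable_fst).
  exact: cmeasurable_expi measurable_dot_pair.
have := cintegral_fubini mF (integrable_cabs gi) (integrable_cabs fi) _.
rewrite /F /= => H; transitivity (cintegral (fun x => cintegral (fun y =>
    expi (dot x y) * g x * f y))).
  congr cintegral; apply/funext => x.
  rewrite /ift mulrC -cintegralZ; last exact: cintegrable_expi.
  by congr cintegral; apply/funext => y; rewrite mulrA [g x * _]mulrC.
rewrite H; last by move=> x y; rewrite !cabsM cabs_expi mul1r.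
congr cintegral; apply/funext => y.
rewrite /ift -cintegralZ; last exact: cintegrable_expi.
by congr cintegral; apply/funext => x; rewrite dotC; ring.
Qed.

End inverse_fourier.

(** * Schwartz functions and the transform of a derivative *)

Section schwartz_theory.
Context {R : realType} {n : nat}.
Implicit Types (f g h phi : 'rV[R]_n -> R[i]) (x y xi : 'rV[R]_n) (i : 'I_n).
Local Notation mu := (@lebesgue_row R n).

Lemma schwartz_partial i phi : schwartz phi -> schwartz (partial i phi).
Proof.
move=> [sp hp]; split; first exact: smooth_partial.
by move=> s m; have := hp (rcons s i) m; rewrite /partials foldr_rcons.
Qed.

Lemma schwartz_partials (s : seq 'I_n) phi : schwartz phi ->
  schwartz (partials s phi).
Proof.
by elim: s phi => //= i s IH phi sp; apply: schwartz_partial; exact: IH.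
Qed.

Lemma schwartz_decay phi : schwartz phi ->
  exists M : R, forall x, cabs (phi x) <= M * decay x.
Proof. by move=> [_ /(_ [::])]; exact: le_decay. Qed.

Lemma decay_bound_ge0 f (M : R) : (forall x, cabs (f x) <= M * decay x) ->
  0 <= M.
Proof.
move=> /(_ 0) /(le_trans (cabs_ge0 _)).
by rewrite pmulr_lge0 // decay_gt0.
Qed.

Lemma schwartz_continuous phi : schwartz phi -> continuous phi.
Proof. by move=> [/smooth_continuous]. Qed.

Lemma cintegrable_decay f (M : R) : cmeasurable f ->
  (forall x, cabs (f x) <= M * decay x) -> cintegrable f.
Proof.
move=> mf hf; apply: (cintegrable_le (g := fun x => M * decay x)) => //.
by apply: integrableZl_EFin; exact: integrable_decay.
Qed.

Lemma schwartz_cintegrable phi : schwartz phi -> cintegrable phi.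
Proof.
move=> sp; have [M hM] := schwartz_decay sp; apply: cintegrable_decay hM.
exact: continuous_cmeasurable (schwartz_continuous sp).
Qed.

Lemma decay_le1 x : decay x <= 1.
Proof.
apply: prodr_ile1 => i _; rewrite invr_ge0 (le_trans ler01) ?oneDsqr_ge1 //=.
by rewrite invf_le1 ?oneDsqr_ge1 // (lt_le_trans ltr01) ?oneDsqr_ge1.
Qed.

Lemma schwartz_bounded phi : schwartz phi ->
  exists M : R, forall x, cabs (phi x) <= M.
Proof.
move=> sp; have [M hM] := schwartz_decay sp; exists M => x.
apply: (le_trans (hM x)); rewrite ler_piMr ?decay_le1 //.
exact: decay_bound_ge0 hM.
Qed.

Lemma harmonic_gt0 k : 0 < k.+1%:R^-1 :> R.
Proof. by rewrite invr_gt0 ltr0n. Qed.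

Lemma is_derive_cvg_seq (h : R -> R) (d : R) : is_derive (0 : R) 1 h d ->
  k.+1%:R * (h k.+1%:R^-1 - h 0) @[k --> \oo] --> d.
Proof.
move=> [/cvg_ex[l hl] <-].
have -> : 'D_1 h 0 = l by exact: cvg_lim hl.
rewrite (_ : (fun k => _) = fun k => (k.+1%:R^-1)^-1 *:
    ((h \o shift 0) (k.+1%:R^-1 *: 1) - h 0)); last first.
  by apply/funext => k; rewrite /= invrK addr0 [_%:A]mulr1.
apply: (iffLR (cvgr_dnbhsP _ _ _) hl); split; last exact: cvg_harmonic.
by move=> k; rewrite gt_eqF // harmonic_gt0.
Qed.

Lemma is_derive_line_shift (h : 'rV[R]_n -> R) x v (s : R) d :
  is_derive (s *: v + x) v h d -> is_derive s 1 (fun t : R => h (t *: v + x)) d.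
Proof.
move=> /is_derive_line hd.
rewrite (_ : (fun t => _) =
    (fun t => h (t *: v + (s *: v + x))) \o (fun t => t - s)); last first.
  by apply/funext => t /=; rewrite addrA -scalerDl subrK.
rewrite -[d]mulr1; apply: is_derive1_comp; first by rewrite subrr.
by apply: is_derive_eq; rewrite subr0.
Qed.

(** The mean value theorem evaluates h' at a point within distance 1 of [x], where the weight is at
    most 3 times its value at [x]. After division by [t] the bound no longer depends on [t]. *)
Lemma ler_line_derive (h h' : 'rV[R]_n -> R) x i (M : R) (t : R) :
  0 <= M -> 0 < t <= 1 ->
  (forall y, is_derive y (delta_mx ord0 i) h (h' y)) ->
  (forall y, `|h' y| <= M * decay y) ->
  `|h (t *: delta_mx ord0 i + x) - h x| <= t * (3 * M * decay x).
Proof.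
move=> M0 /andP[t0 t1] hd hM.
have D (s : R) := is_derive_line_shift (hd (s *: delta_mx ord0 i + x)).
have [|c] := @MVT_segment R (fun t : R => h (t *: delta_mx ord0 i + x))
  (fun s => h' (s *: delta_mx ord0 i + x)) 0 t (ltW t0) (fun s _ => D s).
  apply: continuous_subspaceT => s.
  by apply/differentiable_continuous/derivable1_diffP; have [] := D s.
rewrite in_itv /= => /andP[c0 ct]; rewrite scale0r add0r subr0 => ->.
rewrite normrM (ger0_norm (ltW t0)) mulrC ler_pM2l //.
apply: (le_trans (hM _)); rewrite (mulrC 3) -mulrA ler_wpM2l //.
rewrite addrC decay_shift // ger0_norm //; exact: le_trans ct t1.
Qed.

(* Instead of integrating by parts, translation invariance is applied to the
  difference quotients of [phi] in direction i, which are dominated by a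
  multiple of [decay]. *)
Lemma ift_partial i phi y : schwartz phi ->
  ift (partial i phi) y = - ('i%C * (y ord0 i)%:C%C) * ift phi y.
Proof.
move=> sp; have pi := schwartz_cintegrable sp.
have [M hM] := schwartz_decay (schwartz_partial i sp).
have M0 := decay_bound_ge0 hM.
have dphi x : is_cderive x i phi (partial i phi x).
  by apply: is_cderive_partial; exact: (sp.1 [::]).2.
pose e_ : 'rV[R]_n := delta_mx ord0 i; pose t k : R := k.+1%:R^-1.
pose D k x := (k.+1%:R : R)%:C%C * (phi (t k *: e_ + x) - phi x).
have shift_i k : cintegrable (fun x => phi (t k *: e_ + x)).
  by have := cintegrable_affine (t k *: e_) ltr01 pi;
    under eq_fun do rewrite scale1r.
have Di k : cintegrable (D k).
  apply: cintegrableZ; apply: cintegrableD => //; exact: cintegrableN.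
(* Translating [phi] by t along the i-th axis multiplies its transform by exp(-i t y_i), by
   translation invariance of the integral. *)
have iD k : ift (D k) y =
    (k.+1%:R : R)%:C%C * (expi (- (t k * y ord0 i)) - 1) * ift phi y.
  rewrite iftZ; last by apply: cintegrableD => //; exact: cintegrableN.
  rewrite -mulrA; congr (_ * _); rewrite iftD //; last exact: cintegrableN.
  have -> : ift (fun x => - phi x) y = - ift phi y.
    by under eq_fun do rewrite -mulN1r; rewrite iftZ // mulN1r.
  rewrite mulrBl mul1r; congr (_ - _).
  rewrite /ift -cintegralZ; last exact: cintegrable_expi.
  have := @cintegral_affine R n (t k *: e_) 1 ltr01
    (fun x => expi (- (t k * y ord0 i)) * (expi (dot y x) * phi x)) _.
  rewrite expr1n mul1r => <-; last first.
    by apply: cintegrableZ; exact: cintegrable_expi.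
  congr cintegral; apply/funext => x.
  rewrite scale1r mulrA -expiD dotDr dotZr (dotC y e_) dot_delta.
  by rewrite addrA addNr add0r.
have lim1 : ccvg (fun k => ift (D k) y) (ift (partial i phi) y).
  (* The 3 comes from shifting the weight, the 2 from applying the mean value theorem to the real
     and imaginary parts separately. *)
  apply: (cintegral_ccvg (g := fun x => 2 * (3 * M) * decay x)).
  - by move=> k; exact: cintegrable_measurable (cintegrable_expi y (Di k)).
  - apply: cintegrable_measurable; apply: cintegrable_expi.
    exact: schwartz_cintegrable (schwartz_partial i sp).
  - by apply: integrableZl_EFin; exact: integrable_decay.
  - move=> x; apply: ccvgM; first exact: ccvg_cst.
    have [d1 d2] := dphi x; apply/ccvg_ReIm; split.
      rewrite (_ : (fun k => _) = fun k => k.+1%:R *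
          (complex.Re (phi (t k *: e_ + x)) - complex.Re (phi (0 *: e_ + x)))).
        exact: (is_derive_cvg_seq (iffRL (is_derive_line _ _ _ _) d1)).
      by apply/funext => k; rewrite /D cReM cReD cReN /= mul0r subr0 scale0r
        add0r.
    rewrite (_ : (fun k => _) = fun k => k.+1%:R *
        (complex.Im (phi (t k *: e_ + x)) - complex.Im (phi (0 *: e_ + x)))).
      exact: (is_derive_cvg_seq (iffRL (is_derive_line _ _ _ _) d2)).
    by apply/funext => k; rewrite /D cImM cImD cImN /= mul0r addr0 scale0r
      add0r.
  - move=> k x; rewrite cabsM cabs_expi mul1r cabsM cabs_real ger0_norm //.
    rewrite mulrC -ler_pdivlMr ?ltr0n // (le_trans (ler_cabs_ReIm _)) //.
    rewrite cReD cReN cImD cImN.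
    have tk : 0 < t k <= 1 by rewrite harmonic_gt0 invf_le1 ?ltr0n // ler1n.
    have -> : 2 * (3 * M) * decay x / k.+1%:R =
        t k * (3 * M * decay x) + t k * (3 * M * decay x) by rewrite /t; ring.
    apply: lerD.
      apply: (ler_line_derive x M0 tk (fun y => (dphi y).1)) => z.
      exact: le_trans (ler_Re_cabs _) (hM z).
    apply: (ler_line_derive x M0 tk (fun y => (dphi y).2)) => z.
    exact: le_trans (ler_Im_cabs _) (hM z).
apply: (ccvg_unique lim1); apply: (ccvg_eq (fun k => esym (iD k))).
apply: ccvgM; last exact: ccvg_cst.
(* The multiplier (k+1)(exp(-i y_i/(k+1)) - 1) is a difference quotient at 0 of s |-> exp(-i s y_i),
   computed through cosine and sine. *)
have dc : is_derive (0 : R) 1 (fun s => cos (- (s * y ord0 i))) 0.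
  apply: (is_derive_eq (is_derive1_comp (f := cos)
    (g := fun s => - (s * y ord0 i)) (is_derive_cos _) _)).
  by rewrite mul0r oppr0 sin0 oppr0 mul0r.
have ds : is_derive (0 : R) 1 (fun s => sin (- (s * y ord0 i))) (- y ord0 i).
  have d0 : is_derive (0 : R) 1 (fun s => - (s * y ord0 i)) (- y ord0 i).
    apply: is_derive_eq; rewrite /GRing.scale /=; ring.
  apply: (is_derive_eq (is_derive1_comp (f := sin) (is_derive_sin _) d0)).
  by rewrite mul0r oppr0 cos0 mul1r.
apply/ccvg_ReIm; split.
  have := is_derive_cvg_seq dc; rewrite mul0r oppr0 cos0.
  rewrite (_ : complex.Re (- _) = 0); last by rewrite /=; ring.
  under [X in _ -> X @ _ --> _]eq_fun do rewrite cReM cReD cReN /= mul0r subr0.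
  exact.
have := is_derive_cvg_seq ds; rewrite mul0r oppr0 sin0 oppr0.
rewrite (_ : complex.Im (- _) = - y ord0 i); last by rewrite /=; ring.
under [X in _ -> X @ _ --> _]eq_fun do rewrite cImM cImD cImN /= mul0r addr0
  oppr0.
exact.
Qed.

End schwartz_theory.

(** * Decay of the transform of a Schwartz function *)

Section fourier_schwartz.
Context {R : realType} {n : nat}.
Implicit Types (f g h phi : 'rV[R]_n -> R[i]) (x y xi : 'rV[R]_n) (i : 'I_n).
Local Notation mu := (@lebesgue_row R n).

Lemma cabs_ift_partials (s : seq 'I_n) phi y : schwartz phi ->
  cabs (ift (partials s phi) y) = `|\prod_(i <- s) y ord0 i| * cabs (ift phi y).
Proof.
move=> sp; elim: s => [|i s IH]; first by rewrite big_nil normr1 mul1r.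
rewrite /= ift_partial; last exact: schwartz_partials.
by rewrite cabsM IH cabsN cabsM cabs_i mul1r cabs_real big_cons normrM mulrA.
Qed.

(** A monomial times the transform has the modulus of the transform of a derivative, which is
    bounded by an L^1 norm. The resulting decay makes the transform integrable. *)
Lemma ift_schwartz_decay phi : schwartz phi ->
  exists M : R, forall y, cabs (ift phi y) <= M * decay y.
Proof.
move=> sp; apply: le_decay => m.
(* The list of derivatives in which each index i occurs [m i] times. *)
pose s := flatten [seq nseq (m i) i | i <- index_enum 'I_n].
exists (2 * L1norm (partials s phi)) => y.
have -> : \prod_(i < n) y ord0 i ^+ m i = \prod_(i <- s) y ord0 i.
  rewrite big_flatten big_map; apply: eq_bigr => i _.
  by rewrite big_nseq -Monoid.iteropE.
rewrite -cabs_ift_partials //; apply: ler_cabs_ift.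
exact: schwartz_cintegrable (schwartz_partials s sp).
Qed.

Lemma cintegrable_ift_schwartz phi : schwartz phi -> cintegrable (ift phi).
Proof.
move=> sp; have [M hM] := ift_schwartz_decay sp; apply: cintegrable_decay hM.
exact: continuous_cmeasurable (continuous_ift (schwartz_cintegrable sp)).
Qed.

Lemma decay_opp x : decay (- x) = decay x :> R.
Proof. by apply: eq_bigr => i _; rewrite mxE /oneDsqr sqrrN. Qed.

Lemma cmeasurable_opp f : cmeasurable f -> cmeasurable (fun x => f (- x)).
Proof.
move=> mf; apply: (cmeasurable_comp mf); apply: measurable_fun_row => i.
under eq_fun do rewrite mxE; apply: measurableT_comp => //.
exact: measurable_coor.
Qed.

Lemma cintegrable_fourier_schwartz phi : schwartz phi ->
  cintegrable (fourier phi).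
Proof.
move=> sp; have [M hM] := ift_schwartz_decay sp.
rewrite (_ : fourier phi = fun xi => ift phi (- xi)); last first.
  by apply/funext => xi; exact: fourier_ift.
apply: (@cintegrable_decay _ _ _ M).
  apply: cmeasurable_opp; apply: cintegrable_measurable.
  exact: cintegrable_ift_schwartz.
by move=> x; rewrite -decay_opp.
Qed.

Lemma cintegrable_sum (I : Type) (r : seq I) (F : I -> 'rV[R]_n -> R[i]) :
  (forall a, cintegrable (F a)) -> cintegrable (fun x => \sum_(a <- r) F a x).
Proof.
move=> Fi; elim: r => [|a r IH].
  under eq_fun do rewrite big_nil.
  by split; exact: integrable0.
by under eq_fun do rewrite big_cons; exact: cintegrableD.
Qed.

Lemma ift_sum (I : Type) (r : seq I) (F : I -> 'rV[R]_n -> R[i]) y :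
  (forall a, cintegrable (F a)) ->
  ift (fun x => \sum_(a <- r) F a x) y = \sum_(a <- r) ift (F a) y.
Proof.
move=> Fi; elim: r => [|a r IH].
  rewrite big_nil /ift; under eq_fun do rewrite big_nil mulr0.
  exact: cintegral0.
under eq_fun do rewrite big_cons; rewrite iftD ?IH ?big_cons //.
exact: cintegrable_sum.
Qed.

Lemma ift_laplacian phi y : schwartz phi ->
  ift (laplacian phi) y = - (dot y y)%:C%C * ift phi y.
Proof.
move=> sp; rewrite /laplacian ift_sum; last first.
  by move=> i; exact: schwartz_cintegrable (schwartz_partials [:: i; i] sp).
rewrite /dot rmorph_sum -sumrN mulr_suml; apply: eq_bigr => i _.
rewrite !ift_partial //; last exact: schwartz_partial.
by rewrite mulrA; congr (_ * _); rewrite mulrNN mulrACA -expr2 sqr_i rmorphM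
  mulN1r.
Qed.

Lemma cintegrable_laplacian phi : schwartz phi -> cintegrable (laplacian phi).
Proof.
move=> sp; apply: cintegrable_sum => i.
exact: schwartz_cintegrable (schwartz_partials [:: i; i] sp).
Qed.

End fourier_schwartz.

(** * Fourier inversion *)

Section inversion.
Context {R : realType} {n : nat}.
Implicit Types (f g h w phi : 'rV[R]_n ->
  R[i]) (x y a xi : 'rV[R]_n) (i : 'I_n).
Local Notation mu := (@lebesgue_row R n).

Lemma cintegral_fourierC f g : cintegrable f -> cintegrable g ->
  cintegral (fun x => fourier f x * g x) = cintegral (fun xi =>
    f xi * fourier g xi).
Proof.
move=> fi gi.
have mf := cintegrable_measurable fi; have mg := cintegrable_measurable gi.
pose F (p : 'rV[R]_n * 'rV[R]_n) := expi (- dot p.1 p.2) * g p.1 * f p.2.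
have mF : cmeasurable F.
  apply: cmeasurableM; last exact: (cmeasurable_comp mf measurable_snd).
  apply: cmeasurableM; last exact: (cmeasurable_comp mg measurable_fst).
  by apply: cmeasurable_expi; apply: measurableT_comp => //;
    exact: measurable_dot_pair.
have ker h x : cintegrable h -> cintegrable (fun xi =>
  expi (- dot xi x) * h xi).
  move=> hi; under eq_fun do rewrite -dotNr dotC.
  exact: cintegrable_expi.
have := cintegral_fubini mF (integrable_cabs gi) (integrable_cabs fi) _.
rewrite /F /= => H; transitivity (cintegral (fun x => cintegral (fun y =>
    expi (- dot x y) * g x * f y))).
  congr cintegral; apply/funext => x.
  rewrite /fourier mulrC -cintegralZ; last exact: ker.
  by congr cintegral; apply/funext => y; rewrite dotC; ring.
rewrite H; last by move=> x y; rewrite !cabsM cabs_expi mul1r.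
congr cintegral; apply/funext => y.
rewrite /fourier -cintegralZ; last exact: ker.
by congr cintegral; apply/funext => x; ring.
Qed.

Lemma is_fourier_schwartz phi : schwartz phi -> is_fourier phi (fourier phi).
Proof.
move=> sp; split; first exact: cintegrable_fourier_schwartz.
by move=> psi spsi; rewrite cintegral_fourierC //; exact: schwartz_cintegrable.
Qed.

Lemma is_fourier_ae_unique w g h : is_fourier w g -> is_fourier w h ->
  {ae mu, forall x, g x = h x}.
Proof.
move=> [gi wg] [hi wh].
have : {ae mu, forall x, g x - h x = 0}.
  apply: test_ae0; first by apply: cintegrableD => //; exact: cintegrableN.
  move=> phi tp; have sp := test_function_schwartz tp.
  have [M hM] := schwartz_bounded sp.
  have mp := continuous_cmeasurable (schwartz_continuous sp).
  have prod f : cintegrable f -> cintegrable (fun x => f x * phi x).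
    by move=> fi; under eq_fun do rewrite mulrC; exact: cintegrableMl hM fi.
  under eq_fun do rewrite mulrBl.
  rewrite cintegralB; [|exact: prod..].
  by rewrite -wg // -wh // subrr.
by apply: filterS => x /eqP; rewrite subr_eq0 => /eqP.
Qed.

Definition unit_bump x : R := box_bump (fun=> -1) (fun=> 1) 1 x.

Definition cunit_bump x : R[i] := (unit_bump x)%:C%C.

(** An affine change of variable turns the unit bump into a box bump again: the faces move to (-1 -
    a_i)/e and (1 - a_i)/e, and the sharpness becomes [e]. *)
Lemma test_function_unit_bump a (e : R) : 0 < e ->
  test_function (fun x => cunit_bump (a + e *: x)).
Proof.
move=> e0; rewrite (_ : (fun x => _) = fun x => (box_bump
    (fun i => (- 1 - a ord0 i) / e) (fun i => (1 - a ord0 i) / e) e x)%:C%C).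
  exact: test_function_box_bump.
apply/funext => x; rewrite /cunit_bump /unit_bump /box_bump; congr (_%:C%C).
apply: eq_bigr => i _; rewrite !mxE !mul1r !mulrBr.
by congr (flat _ _ * flat _ _); field; rewrite gt_eqF.
Qed.

Lemma schwartz_unit_bump : schwartz cunit_bump.
Proof.
apply: test_function_schwartz; have := @test_function_unit_bump 0 1 ltr01.
by under eq_fun do rewrite add0r scale1r.
Qed.

Lemma unit_bump0_gt0 : 0 < unit_bump 0.
Proof.
apply: box_bump_gt0 => //; apply/open_boxP => i.
by rewrite mxE ltrN10 ltr01.
Qed.

Lemma cunit_bump0_neq0 : cunit_bump 0 != 0.
Proof. by rewrite -cabs_eq0 cabs_real normr_eq0 gt_eqF ?unit_bump0_gt0. Qed.

Lemma cabs_unit_bump x : cabs (cunit_bump x) <= 1.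
Proof. by rewrite cabs_real ger0_norm ?box_bump_ge0 ?box_bump_le1. Qed.

Lemma ccvg_dilate f a x : continuous f ->
  ccvg (fun k => f (a + k.+1%:R^-1 *: x)) (f a).
Proof.
move=> cf; apply: ccontinuous_seq; first exact: cf.
move=> i; have : a ord0 i + k.+1%:R^-1 * x ord0 i @[k --> \oo] -->
    a ord0 i + 0 * x ord0 i.
  apply: cvgD; first exact: cvg_cst.
  by apply: cvgM; [exact: cvg_harmonic|exact: cvg_cst].
rewrite mul0r addr0; rewrite (_ : (fun k => _) = fun k =>
    (a + k.+1%:R^-1 *: x) ord0 i) //.
by apply/funext => k; rewrite !mxE.
Qed.

(** Modulation by exp(i a.xi) recentres the transform at [a] and dilation by [e] rescales it around
    that point, which makes it concentrate at [a] as e tends to 0. *)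
Lemma fourier_dilated g a y (e : R) : 0 < e -> cintegrable g ->
  (e ^+ n)%:C%C * fourier (fun xi => expi (dot xi a) * g (e *: xi))
    (a + e *: y) =
  fourier g y.
Proof.
move=> e0 gi.
have Fi : cintegrable (fun x => expi (- dot x y) * g x).
  by under eq_fun do rewrite -dotNr dotC; exact: cintegrable_expi.
rewrite -[RHS](cintegral_affine 0 e0 Fi); congr (_ * cintegral _).
apply/funext => xi; rewrite add0r mulrA -expiD dotDr dotZr dotZl.
by congr (expi _ * _); ring.
Qed.

Lemma is_fourier_dilated w h a (e : R) : 0 < e -> bounded_continuous w ->
  is_fourier w h ->
  cintegral (fun y => w (a + e *: y) * fourier cunit_bump y) =
  cintegral (fun xi => h xi * (expi (dot xi a) * cunit_bump (e *: xi))).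
Proof.
move=> e0 [cw [M wM]] [hi wh].
pose phi xi := expi (dot xi a) * cunit_bump (e *: xi).
have sp : schwartz phi.
  apply/test_function_schwartz/test_functionM; first exact: smooth_expi.
  by have := @test_function_unit_bump 0 e e0; under eq_fun do rewrite add0r.
have wi : cintegrable (fun x => w x * fourier phi x).
  apply: cintegrableMl wM _; first exact: continuous_cmeasurable.
  exact: cintegrable_fourier_schwartz.
rewrite -[RHS](wh phi sp) -(cintegral_affine a e0 wi).
rewrite -[RHS]cintegralZ; last exact: (cintegrable_affine a e0 wi).
congr cintegral; apply/funext => y; rewrite mulrCA; congr (_ * _).
rewrite fourier_dilated //.
exact: schwartz_cintegrable schwartz_unit_bump.
Qed.

(** Two dominated limits of the same sequence, with e = 1/(k+1). The frequency side is dominated by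
    |h|; the space side by M times the modulus of the transform of the bump, which is where
    boundedness and continuity of [w] enter. *)
Lemma is_fourier_inversion w h a : bounded_continuous w -> is_fourier w h ->
  cunit_bump 0 * ift h a = w a * cintegral (fourier cunit_bump).
Proof.
move=> bw wh; have [cw [M wM]] := bw; have [hi _] := wh.
have cb := schwartz_continuous schwartz_unit_bump.
have fi := cintegrable_fourier_schwartz schwartz_unit_bump.
have mh := cintegrable_measurable hi.
have mexp : cmeasurable (fun xi => expi (dot xi a)).
  by under eq_fun do rewrite dotC; exact: cmeasurable_expi (measurable_dot a).
have lim1 : ccvg (fun k => cintegral (fun xi => h xi *
    (expi (dot xi a) * cunit_bump (k.+1%:R^-1 *: xi))))
      (cunit_bump 0 * ift h a).
  rewrite /ift -cintegralZ; last exact: cintegrable_expi.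
  apply: (cintegral_ccvg (g := fun xi => cabs (h xi))).
  - move=> k; apply: cmeasurableM => //; apply: cmeasurableM => //.
    have [] := @test_function_unit_bump 0 _ (harmonic_gt0 k).
    move=> /smooth_continuous/continuous_cmeasurable.
    by under eq_fun do rewrite add0r.
  - apply: cmeasurableM; first exact: cmeasurable_cst.
    exact: cintegrable_measurable (cintegrable_expi a hi).
  - exact: integrable_cabs.
  - move=> xi; rewrite (_ : cunit_bump 0 * _ =
        h xi * (expi (dot xi a) * cunit_bump 0)); last by rewrite dotC; ring.
    do 2 (apply: ccvgM; first exact: ccvg_cst).
    have := @ccvg_dilate cunit_bump 0 xi cb.
    by apply: ccvg_eq => k; rewrite add0r.
  - move=> k xi; rewrite !cabsM cabs_expi mul1r ler_piMr ?cabs_ge0 //.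
    exact: cabs_unit_bump.
apply: (ccvg_unique lim1).
have lim2 : ccvg (fun k => cintegral (fun y =>
    w (a + k.+1%:R^-1 *: y) * fourier cunit_bump y))
    (w a * cintegral (fourier cunit_bump)).
  rewrite -cintegralZ //.
  apply: (cintegral_ccvg (g := fun xi => M * cabs (fourier cunit_bump xi))).
  - move=> k; apply: cmeasurableM; last exact: cintegrable_measurable.
    apply: (cmeasurable_comp (continuous_cmeasurable cw)).
    exact: measurable_affine_row.
  - by apply: cmeasurableM; [exact: cmeasurable_cst|exact:
    cintegrable_measurable].
  - by apply: integrableZl_EFin; exact: integrable_cabs.
  - move=> y; apply: ccvgM; last exact: ccvg_cst.
    exact: ccvg_dilate.
  - by move=> k y; rewrite cabsM ler_wpM2r ?cabs_ge0.
by apply: ccvg_eq lim2 => k; rewrite (@is_fourier_dilated _ h) // harmonic_gt0.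
Qed.

Lemma cintegral_unit_bump_neq0 : cintegral cunit_bump != 0.
Proof.
apply/eqP => /(congr1 (@complex.Re R)) /= c0.
have ci := schwartz_cintegrable schwartz_unit_bump.
have L0 : L1norm cunit_bump = 0.
  rewrite -[RHS]c0; apply: eq_Rintegral => x _.
  by rewrite cabs_real ger0_norm ?box_bump_ge0.
have /eqP := continuous_cae0 (schwartz_continuous schwartz_unit_bump)
  (L1norm_eq0_ae ci L0) 0.
exact/negP/cunit_bump0_neq0.
Qed.

(* Equal to (2 pi)^n, although only [inversion_constant_neq0] matters. *)
Definition inversion_constant : R[i] :=
  cintegral (fourier cunit_bump) / cunit_bump 0.

Lemma ift_is_fourier w h a : bounded_continuous w -> is_fourier w h ->
  ift h a = inversion_constant * w a.
Proof.
move=> bw wh; apply: (mulfI cunit_bump0_neq0).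
rewrite (is_fourier_inversion a bw wh) /inversion_constant mulrA mulrC.
by congr (_ * _); rewrite mulrC divfK // cunit_bump0_neq0.
Qed.

Lemma ift_fourier_schwartz phi a : schwartz phi ->
  ift (fourier phi) a = inversion_constant * phi a.
Proof.
move=> sp; apply: ift_is_fourier; last exact: is_fourier_schwartz.
by split; [exact: schwartz_continuous|exact: schwartz_bounded].
Qed.

(** If the constant were 0, the transform of the bump would have zero L^2 norm, hence vanish almost
    everywhere, and everywhere by continuity. Its value at the origin is the integral of the bump,
    which is not 0. *)
Lemma inversion_constant_neq0 : inversion_constant != 0.
Proof.
apply/eqP => c0; have sp := schwartz_unit_bump.
have ci := schwartz_cintegrable sp.
(* The bump is real, so its two transforms are conjugate and their product is a squared modulus. *)
have conjE xi : fourier cunit_bump xi = (ift cunit_bump xi)^*%C.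
  have ReE : complex.Re (fourier cunit_bump xi) =
    complex.Re (ift cunit_bump xi).
    by apply: eq_Rintegral => x _; rewrite !cReM /= cosN dotC !mulr0.
  have ImE : complex.Im (fourier cunit_bump xi) =
    - complex.Im (ift cunit_bump xi).
    rewrite -mulN1r -[RHS]RintegralZl //;
      last by case: (cintegrable_expi xi ci).
    by apply: eq_Rintegral => x _; rewrite !cImM /= sinN dotC; ring.
  by apply: complex_eq; rewrite ?ReE ?ImE; case: (ift _ _).
have normE xi : fourier cunit_bump xi * ift cunit_bump xi =
    ((cabs (ift cunit_bump xi)) ^+ 2)%:C%C.
  rewrite conjE cabsE sqr_sqrtr ?addr_ge0 ?sqr_ge0 //.
  by case: (ift _ _) => u v; apply: complex_eq => /=; ring.
have fi := cintegrable_fourier_schwartz sp.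
have /(congr1 (@complex.Re R)) : cintegral (fun xi =>
    fourier cunit_bump xi * ift cunit_bump xi) = 0.
  rewrite -cintegral_iftC //; under eq_fun do rewrite ift_fourier_schwartz //
    c0 !mul0r.
  exact: cintegral0.
move=> I0.
have Fi : cintegrable (fun xi => fourier cunit_bump xi * ift cunit_bump xi).
  have ifti := cintegrable_ift_schwartz sp.
  apply: (cintegrableMl _ (M := 2 * L1norm cunit_bump)) => //.
  + exact: cintegrable_measurable.
  + by move=> xi; rewrite fourier_ift ler_cabs_ift.
have /(L1norm_eq0_ae Fi) F0 :
    L1norm (fun xi => fourier cunit_bump xi * ift cunit_bump xi) = 0.
  rewrite -[RHS]I0; apply: eq_Rintegral => xi _.
  by rewrite normE cabs_real /= ger0_norm ?sqr_ge0.
have ift0 : {ae mu, forall xi, ift cunit_bump xi = 0}.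
  apply: filterS F0 => xi; rewrite normE => -[] /eqP.
  by rewrite sqrf_eq0 cabs_eq0 => /eqP.
have := continuous_cae0 (continuous_ift ci) ift0 0.
rewrite /ift; under eq_fun do rewrite dotC dot0r expi0 mul1r.
exact/eqP/cintegral_unit_bump_neq0.
Qed.

(** The multiplication formula moves the transform from [g] onto [fourier phi], where inversion for
    the Schwartz function [phi] returns [phi] up to the constant. *)
Lemma is_fourier_ift g : cintegrable g ->
  is_fourier (fun x => inversion_constant^-1 * ift g x) g.
Proof.
move=> gi; split=> // phi sp.
have fi := cintegrable_fourier_schwartz sp.
under eq_fun do rewrite -mulrA.
rewrite cintegralZ; last first.
  apply: (cintegrableMl _ (M := 2 * L1norm g)) fi.
    exact: continuous_cmeasurable (continuous_ift gi).
  by move=> x; exact: ler_cabs_ift.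
rewrite cintegral_iftC // -cintegralZ; last first.
  under eq_fun do rewrite mulrC.
  apply: (cintegrableMl _ (M := 2 * L1norm (fourier phi))) gi.
    exact: continuous_cmeasurable (continuous_ift fi).
  by move=> x; exact: ler_cabs_ift.
congr cintegral; apply/funext => xi; rewrite ift_fourier_schwartz //.
by rewrite mulrCA mulKf // inversion_constant_neq0.
Qed.

Lemma bounded_continuous_ift (z : R[i]) g : cintegrable g ->
  bounded_continuous (fun x => z * ift g x).
Proof.
move=> gi; split.
  apply: continuous_cfunM; first exact: cst_continuous.
  exact: continuous_ift.
exists (cabs z * (2 * L1norm g)) => x.
by rewrite cabsM ler_wpM2l ?cabs_ge0 // ler_cabs_ift.
Qed.

Lemma B0_ift g : cintegrable g ->
  B0 (fun x => inversion_constant^-1 * ift g x).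
Proof.
move=> gi; split; first exact: bounded_continuous_ift.
by exists g; exact: is_fourier_ift.
Qed.

(** The form in which membership is used below: algebra in B^0 becomes algebra on integrable
    functions of the frequency. *)
Lemma B0P w : B0 w <-> exists2 g, cintegrable g &
  w = fun x => inversion_constant^-1 * ift g x.
Proof.
split=> [[bw [g wg]]|[g gi ->]]; last exact: B0_ift.
exists g; first by case: wg.
apply/funext => x; rewrite (ift_is_fourier x bw wg).
by rewrite mulKf // inversion_constant_neq0.
Qed.

End inversion.

(** * The Laplacian and its resolvent *)

Section distributional_laplacian.
Context {R : realType} {n : nat}.
Implicit Types (f g h u v w phi : 'rV[R]_n -> R[i]) (x y a xi : 'rV[R]_n).
Local Notation mu := (@lebesgue_row R n).
Local Notation c := (@inversion_constant R n).

Lemma cintegrable_mul_schwartz w phi : bounded_continuous w -> schwartz phi ->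
  cintegrable (fun x => w x * phi x).
Proof.
move=> [cw [M wM]] sp; apply: cintegrableMl wM _.
  exact: continuous_cmeasurable.
exact: schwartz_cintegrable.
Qed.

Lemma cintegrable_mul_ift g phi : cintegrable g -> cintegrable phi ->
  cintegrable (fun xi => g xi * ift phi xi).
Proof.
move=> gi pi; under eq_fun do rewrite mulrC.
apply: (cintegrableMl _ (M := 2 * L1norm phi)) gi.
  exact: continuous_cmeasurable (continuous_ift pi).
by move=> x; exact: ler_cabs_ift.
Qed.

Lemma cintegral_B0 g phi : cintegrable g -> cintegrable phi ->
  cintegral (fun x => c^-1 * ift g x * phi x) =
  c^-1 * cintegral (fun xi => g xi * ift phi xi).
Proof.
move=> gi pi; rewrite -cintegral_iftC //; under eq_fun do rewrite -mulrA.
rewrite cintegralZ //; under eq_fun do rewrite mulrC.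
exact: cintegrable_mul_ift.
Qed.

(** Bounded functions need not be integrable, so [test_ae0] is applied to (u - v) chi for a test
    function [chi] positive at the point considered; chi phi is again a test function. *)
Lemma bounded_continuous_cunique u v : bounded_continuous u ->
  bounded_continuous v ->
  (forall phi, test_function phi ->
    cintegral (fun x => u x * phi x) = cintegral (fun x => v x * phi x)) ->
      u = v.
Proof.
move=> bu bv uv; apply/funext => x; apply/eqP; rewrite -subr_eq0.
have [chi [tchi _ chi0]] := exists_test_function x.
have schi := test_function_schwartz tchi.
have ui := cintegrable_mul_schwartz bu schi.
have vi := cintegrable_mul_schwartz bv schi.
pose k y := u y * (chi y)%:C%C - v y * (chi y)%:C%C.
have k0 : {ae mu, forall y, k y = 0}.
  apply: test_ae0; first by apply: cintegrableD => //; exact: cintegrableN.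
  move=> phi tp; have tcp := test_functionM tchi.1 tp.
  have scp := test_function_schwartz tcp.
  under eq_fun do rewrite /k mulrBl -!mulrA.
  rewrite cintegralB; [|exact: cintegrable_mul_schwartz..].
  by rewrite uv // subrr.
have ck : continuous k.
  rewrite (_ : k = fun y => (u y + -1 * v y) * (chi y)%:C%C); last first.
    by apply/funext => y; rewrite /k mulN1r mulrBl.
  apply: continuous_cfunM; last exact: schwartz_continuous.
  apply: continuous_cfunD; first exact: bu.1.
  by apply: continuous_cfunM; [exact: cst_continuous|exact: bv.1].
have /eqP := continuous_cae0 ck k0 x; rewrite /k -mulrBl mulf_eq0 => /orP[//|].
by rewrite -cabs_eq0 cabs_real normr_eq0 gt_eqF.
Qed.

Lemma distr_laplacian_unique u v v' : bounded_continuous v ->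
  bounded_continuous v' ->
  distr_laplacian u v -> distr_laplacian u v' -> v = v'.
Proof.
move=> bv bv' uv uv'; apply: bounded_continuous_cunique => // phi tp.
by rewrite -uv // -uv'.
Qed.

Lemma distr_laplacian_ift g : cintegrable g ->
  cintegrable (fun xi => - (dot xi xi)%:C%C * g xi) ->
  distr_laplacian (fun x => c^-1 * ift g x)
    (fun x => c^-1 * ift (fun xi => - (dot xi xi)%:C%C * g xi) x).
Proof.
move=> gi gi2 phi /test_function_schwartz sp.
rewrite (cintegral_B0 gi (cintegrable_laplacian sp)).
rewrite [RHS](cintegral_B0 gi2 (schwartz_cintegrable sp)).
congr (_ * cintegral _); apply/funext => xi.
by rewrite ift_laplacian // mulrCA mulrA.
Qed.

Lemma ift_translate phi a xi : cintegrable phi ->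
  ift (fun x => phi (x - a)) xi = expi (dot xi a) * ift phi xi.
Proof.
move=> pi; have pai : cintegrable (fun x => phi (x - a)).
  have := cintegrable_affine (- a) ltr01 pi.
  by under eq_fun do rewrite scale1r addrC.
rewrite [LHS]/ift -(cintegral_affine a ltr01); last exact: cintegrable_expi.
rewrite expr1n mul1r /ift -cintegralZ; last exact: cintegrable_expi.
congr cintegral; apply/funext => x.
by rewrite scale1r addrAC subrr add0r mulrA -expiD dotDr.
Qed.

Let bump_k (k : nat) x : R[i] := cunit_bump (k.+1%:R *: x).

Let test_bump_k k a : test_function (fun x => bump_k k (x - a)).
Proof.
have := @test_function_unit_bump R n (- (k.+1%:R *: a)) k.+1%:R (ltr0Sn _ _).
by under eq_fun do rewrite addrC -scalerBr.
Qed.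

Let test_bump_k0 k : test_function (bump_k k).
Proof. by have := test_bump_k k 0; under eq_fun do rewrite subr0. Qed.

(** Up to a nonzero factor the transform of the k-th bump at [xi] is that of the unit bump at
    xi/(k+1). If all were 0, continuity at the origin would make the integral of the unit bump
    vanish. *)
Let ift_bump_k_neq0 xi : exists k, ift (bump_k k) xi != 0.
Proof.
apply: contrapT => /forallNP h.
have ci := schwartz_cintegrable (@schwartz_unit_bump R n).
have E k : ift cunit_bump (0 + k.+1%:R^-1 *: xi) = 0.
  have k0 : 0 < k.+1%:R :> R by rewrite ltr0n.
  rewrite add0r /ift -(cintegral_affine 0 k0); last exact: cintegrable_expi.
  have /negP/negPn/eqP := h k; rewrite /ift => h0.
  rewrite -[RHS](mulr0 ((k.+1%:R ^+ n)%:C%C)) -h0; congr (_ * cintegral _).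
  apply/funext => x; rewrite add0r dotZl dotZr mulrA mulVf ?mul1r //.
have lim := @ccvg_dilate _ _ _ 0 xi (continuous_ift ci).
have := ccvg_unique lim (ccvg_eq (fun k => esym (E k)) (ccvg_cst 0)).
rewrite /ift; under eq_fun do rewrite dotC dot0r expi0 mul1r.
exact/eqP/cintegral_unit_bump_neq0.
Qed.

Lemma helmholtz_injective w (z : R[i]) : B0 w ->
  (forall xi : 'rV[R]_n, z - (dot xi xi)%:C%C != 0) ->
  distr_laplacian w (fun x => - z * w x) -> w = fun=> 0.
Proof.
move=> /B0P[h hi ->] zxi wz.
(* The transform of (z + Delta) applied to the k-th bump. As a sum of transforms of integrable
   functions it is plainly bounded and continuous, whereas the factored form [mE] contains the
   unbounded factor z - |xi|^2. *)
pose m k xi := z * ift (bump_k k) xi + ift (laplacian (bump_k k)) xi.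
have sk k := test_function_schwartz (test_bump_k0 k).
have bi k := schwartz_cintegrable (sk k).
have mE k xi : m k xi = (z - (dot xi xi)%:C%C) * ift (bump_k k) xi.
  by rewrite /m ift_laplacian // mulrDl.
have cm k : cmeasurable (m k).
  apply: continuous_cmeasurable; apply: continuous_cfunD.
    apply: continuous_cfunM; first exact: cst_continuous.
    exact: continuous_ift.
  exact: continuous_ift (cintegrable_laplacian (sk k)).
have Gi k : cintegrable (fun xi => m k xi * h xi).
  apply: (cintegrableMl (cm k) (M := cabs z * (2 * L1norm (bump_k k)) +
    2 * L1norm (laplacian (bump_k k)))) hi => xi.
  rewrite (le_trans (ler_cabsD _ _)) // lerD //.
    by rewrite cabsM ler_wpM2l ?cabs_ge0 // ler_cabs_ift.
  by apply: ler_cabs_ift; exact: cintegrable_laplacian.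
(* Testing the equation on the bump translated by [x] puts the character exp(i x.xi) under the
   integral, so the tested identity is exactly a value of the transform of m h. *)
have G0 k x : ift (fun xi => m k xi * h xi) x = 0.
  have tp := test_bump_k k x; have sp := test_function_schwartz tp.
  have pi := schwartz_cintegrable sp.
  have := wz _ tp.
  rewrite (cintegral_B0 hi (cintegrable_laplacian sp)).
  under [X in _ = cintegral X -> _]eq_fun do rewrite -mulrA.
  rewrite cintegralZ; last first.
    by apply: cintegrable_mul_schwartz => //; exact: bounded_continuous_ift.
  rewrite (cintegral_B0 hi pi) mulrCA =>
    /(mulfI (invr_neq0 (inversion_constant_neq0))).
  move=> /eqP; rewrite -subr_eq0 mulNr opprK => /eqP H.
  rewrite -[RHS]H -cintegralZ; last exact: cintegrable_mul_ift.
  rewrite -cintegralD; first last.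
  - by apply: cintegrableZ; exact: cintegrable_mul_ift.
  - by apply: cintegrable_mul_ift => //; exact: cintegrable_laplacian.
  congr cintegral; apply/funext => xi.
  rewrite mE ift_laplacian // ift_translate // (dotC xi x); ring.
have Gae k : {ae mu, forall xi, m k xi * h xi = 0}.
  have zi : cintegrable (fun _ : 'rV[R]_n => 0 : R[i]).
    by split; exact: integrable0.
  apply: (is_fourier_ae_unique (is_fourier_ift (Gi k))).
  rewrite (_ : (fun x => _) = fun x => c^-1 * ift (fun=> 0) x).
    exact: is_fourier_ift.
  apply/funext => x; rewrite G0 /ift; congr (_ * _).
  by under eq_fun do rewrite mulr0; rewrite cintegral0.
have h0 : {ae mu, forall xi, h xi = 0}.
  (* The index with nonzero transform depends on [xi]; there are countably many indices, so one null
     set serves them all. *)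
  have : {ae mu, forall xi, forall k, m k xi * h xi = 0} by exact: ae_foralln.
  apply: filterS => xi H; have [k] := ift_bump_k_neq0 xi.
  move=> /negPf kxi; have /eqP := H k; rewrite mE !mulf_eq0 kxi (negPf (zxi
    xi)) /=.
  by move/eqP.
by apply/funext => x; rewrite ift_ae0 // mulr0.
Qed.

End distributional_laplacian.

(** * The closed sector of angle pi/2 and its complement *)

Section half_plane.
Context {R : realType}.
Implicit Types z : R[i].

Lemma acos_lt_pihalf (t : R) : 0 < t <= 1 -> `|acos t| < pi / 2.
Proof.
move=> /andP[t0 t1]; have t11 : -1 <= t <= 1 by rewrite t1 andbT (le_trans _
  (ltW t0)).
have := acos_lepi t11; have := acos_ge0 t11; move=> a0 api.
rewrite ger0_norm // -ltr_cos ?in_itv /= ?a0 ?api //.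
  by rewrite cos_pihalf acosK ?in_itv.
by rewrite divr_ge0 ?pi_ge0 //= ler_pdivrMr // ler_peMr ?pi_ge0 // ler1n.
Qed.

Lemma sector_pihalf z : 0 < complex.Re z -> sector (pi / 2) z.
Proof.
move=> z0; have zn : z != 0.
  by apply: contraTneq z0 => ->; rewrite ltxx.
split=> //; have zp : 0 < cabs z.
  by rewrite lt_neqAle eq_sym cabs_eq0 zn cabs_ge0.
have h : `|acos (complex.Re z / cabs z)| < pi / 2.
  apply: acos_lt_pihalf; rewrite divr_gt0 //= ler_pdivrMr // mul1r.
  exact: le_trans (ler_norm _) (ler_Re_cabs z).
by rewrite /arg; case: ifP => // _; rewrite normrN.
Qed.

(** A point with nonnegative real part, including 0 and the imaginary axis, lies in the closure:
    moving it right by half the radius of a ball reaches the open right half-plane within that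
    ball. *)
Lemma Re_lt0_notin_closure_sector z :
  ~ closure (sector (pi / 2)) z -> complex.Re z < 0.
Proof.
move=> nz; rewrite ltNge; apply/negP => z0; apply: nz => A.
move=> /nbhs_ballP[/= e e0 zA].
have [d d0 de] : exists2 d : R, 0 < d & d%:C%C = e.
  case: e e0 zA => d e' /=; rewrite ltcE /= => /andP[/eqP -> d0] _.
  by exists d.
exists (z + (d / 2)%:C%C); split.
  apply: sector_pihalf; rewrite cReD /= ltr_wpDl // divr_gt0 //.
apply: zA; rewrite -de /ball /= opprD addNKr normrN normc_def ltcR /=.
rewrite expr0n addr0 sqrtr_sqr ger0_norm ?divr_ge0 ?ltW //.
by rewrite ltr_pdivrMr // ltr_pMr // ltr1n.
Qed.

(** Subtracting a nonnegative number from a negative real part increases its absolute value and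
    leaves the imaginary part alone. *)
Lemma cabs_subr_ge z (s : R) : complex.Re z < 0 -> 0 <= s ->
  cabs z <= cabs (z - s%:C%C).
Proof.
move=> z0 s0; rewrite !cabsE ler_wsqrtr // cReD cReN cImD cImN /= oppr0 addr0.
by rewrite lerD2r; nra.
Qed.

End half_plane.

(** * The resolvent as a Fourier multiplier *)

Section resolvent_formula.
Context {R : realType} {n : nat}.
Implicit Types (f g h u v w phi : 'rV[R]_n -> R[i]) (x y xi : 'rV[R]_n).
Local Notation mu := (@lebesgue_row R n).
Local Notation c := (@inversion_constant R n).
Variable (z : R[i]).
Hypothesis z0 : complex.Re z < 0.

Definition symbol xi : R[i] := z - (dot xi xi)%:C%C.

Lemma dot_ge0 xi : 0 <= dot xi xi.
Proof. by apply: sumr_ge0 => i _; rewrite -expr2 sqr_ge0. Qed.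

Lemma cabs_z_gt0 : 0 < cabs z.
Proof.
rewrite lt_neqAle cabs_ge0 andbT eq_sym cabs_eq0.
by apply: contraTneq z0 => ->; rewrite ltxx.
Qed.

Lemma cabs_symbol xi : cabs z <= cabs (symbol xi).
Proof. exact: cabs_subr_ge (dot_ge0 xi). Qed.

Lemma symbol_neq0 xi : symbol xi != 0.
Proof.
by rewrite -cabs_eq0 gt_eqF // (lt_le_trans cabs_z_gt0) // cabs_symbol.
Qed.

Lemma continuous_dot_diag : continuous (fun xi : 'rV[R]_n => dot xi xi).
Proof.
apply: continuous_big => [|i _ x]; first exact: add_continuous.
exact: (continuousM (@coord_continuous _ _ _ ord0 i x)
  (@coord_continuous _ _ _ ord0 i x)).
Qed.

Lemma continuous_symbol : continuous symbol.
Proof.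
apply: continuous_cfunD; first exact: cst_continuous.
move=> x; apply/ccontinuous_ReIm; split => /=; last exact: cst_continuous.
exact: (continuousN (@continuous_dot_diag x)).
Qed.

Lemma cmeasurable_symbolV : cmeasurable (fun xi => (symbol xi)^-1).
Proof.
apply: continuous_cmeasurable => x; apply: (@continuousV _ _ symbol).
  exact: symbol_neq0.
exact: continuous_symbol.
Qed.

Lemma cintegrable_divs g : cintegrable g ->
  cintegrable (fun xi => (symbol xi)^-1 * g xi).
Proof.
apply: (@cintegrableMl _ _ (cabs z)^-1); first exact: cmeasurable_symbolV.
move=> xi; rewrite cabsV lef_pV2 ?posrE ?cabs_symbol ?cabs_z_gt0 //.
by rewrite (lt_le_trans cabs_z_gt0) // cabs_symbol.
Qed.

(** From -|xi|^2 = (z - |xi|^2) - z. The right-hand side is visibly integrable, so the candidate has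
    its Laplacian in B^0. *)
Lemma symbolVM_normsq g : (fun xi => - (dot xi xi)%:C%C * ((symbol xi)^-1 * g
  xi)) =
  fun xi => g xi + - z * ((symbol xi)^-1 * g xi).
Proof.
apply/funext => xi; rewrite -[X in X + _](mulVKf (symbol_neq0 xi)) -mulrDl.
congr (_ * _); rewrite /symbol; ring.
Qed.

(** Uniqueness of a bounded continuous distributional Laplacian replaces the choice made by [xget]
    with any known witness. *)
Lemma neg_laplacianE u v : B0 v -> distr_laplacian u v -> neg_laplacian u = - v.
Proof.
move=> v0 uv; rewrite /neg_laplacian; congr (- _); apply: xget_unique => //.
move=> v' [v0' uv']; exact: distr_laplacian_unique v0'.1 v0.1 uv' uv.
Qed.

Definition resolvent_candidate g x : R[i] :=
  c^-1 * ift (fun xi => (symbol xi)^-1 * g xi) x.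

Lemma resolvent_candidateP g : cintegrable g ->
  dom_neg_laplacian (resolvent_candidate g) /\
  z *: resolvent_candidate g - neg_laplacian (resolvent_candidate g) =
  (fun x => c^-1 * ift g x).
Proof.
move=> gi; have si := cintegrable_divs gi.
have ni : cintegrable (fun xi => - (dot xi xi)%:C%C * ((symbol xi)^-1 * g xi)).
  by rewrite symbolVM_normsq; apply: cintegrableD => //; exact: cintegrableZ.
have B0u := B0_ift si; have B0v := B0_ift ni.
have uv := distr_laplacian_ift si ni.
split; first exact: (conj B0u (ex_intro _ _ (conj B0v uv))).
rewrite (neg_laplacianE B0v uv) opprK; apply/funext => x.
change (z * (c^-1 * ift (fun xi => (symbol xi)^-1 * g xi) x) +
  c^-1 * ift (fun xi => - (dot xi xi)%:C%C * ((symbol xi)^-1 * g xi)) x =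
  c^-1 * ift g x).
rewrite symbolVM_normsq iftD //; last exact: cintegrableZ.
by rewrite iftZ //; ring.
Qed.

Lemma cintegralB_laplacian u u' v v' : bounded_continuous u ->
  bounded_continuous u' ->
  bounded_continuous v -> bounded_continuous v' ->
  distr_laplacian u v -> distr_laplacian u' v' ->
  distr_laplacian (fun x => u x - u' x) (fun x => v x - v' x).
Proof.
move=> bu bu' bv bv' uv uv' phi tp.
have sp := test_function_schwartz tp.
have li w : bounded_continuous w -> cintegrable (fun x =>
  w x * laplacian phi x).
  move=> [cw [M wM]]; apply: cintegrableMl wM _.
    exact: continuous_cmeasurable.
  exact: cintegrable_laplacian.
have pi w : bounded_continuous w -> cintegrable (fun x => w x * phi x).
  by move=> bw; exact: cintegrable_mul_schwartz.
under eq_fun do rewrite mulrBl.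
rewrite (cintegralB (li _ bu) (li _ bu')).
under [X in _ = cintegral X]eq_fun do rewrite mulrBl.
by rewrite (cintegralB (pi _ bv) (pi _ bv')) (uv _ tp) (uv' _ tp).
Qed.

Lemma B0D u v : B0 u -> B0 v -> B0 (fun x => u x + v x).
Proof.
move=> /B0P[g gi ->] /B0P[h hi ->]; apply/B0P.
exists (fun x => g x + h x); first exact: cintegrableD.
by apply/funext => x; rewrite iftD // mulrDr.
Qed.

Lemma B0Z (a : R[i]) u : B0 u -> B0 (fun x => a * u x).
Proof.
move=> /B0P[g gi ->]; apply/B0P; exists (fun x => a * g x).
  exact: cintegrableZ.
by apply/funext => x; rewrite iftZ // mulrCA.
Qed.

(** Argues with the Laplacians v and v' as witnesses: equality of the images says v - v' = -z (u -
    u'), so the difference solves the homogeneous equation. *)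
Lemma resolvent_injective u u' : dom_neg_laplacian u -> dom_neg_laplacian u' ->
  z *: u - neg_laplacian u = z *: u' - neg_laplacian u' -> u = u'.
Proof.
move=> [u0 [v [v0 uv]]] [u0' [v' [v0' uv']]].
rewrite (neg_laplacianE v0 uv) (neg_laplacianE v0' uv') !opprK => E.
pose w x := u x - u' x.
have w0 : B0 w.
  rewrite (_ : w = fun x => u x + -1 * u' x); first by apply: B0D => //;
    exact: B0Z.
  by apply/funext => x; rewrite mulN1r.
have wz : distr_laplacian w (fun x => - z * w x).
  rewrite (_ : (fun x => - z * w x) = fun x => v x - v' x).
    exact: cintegralB_laplacian u0.1 u0'.1 v0.1 v0'.1 uv uv'.
  apply/funext => x; have : z * u x + v x = z * u' x + v' x := congr1 (@^~ x) E.
  move=> Ex; have -> : v x = z * u' x + v' x - z * u x.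
    by rewrite -Ex addrAC subrr add0r.
  by rewrite /w; ring.
have w00 := helmholtz_injective w0 symbol_neq0 wz.
apply/funext => x; apply/eqP; rewrite -subr_eq0; apply/eqP.
exact: (congr1 (@^~ x) w00).
Qed.

Lemma B0_fhat f : B0 f -> is_fourier f (fhat f).
Proof. by move=> [_ ex]; exact: xgetPex ex. Qed.

(** The norm is defined through a chosen transform; almost everywhere uniqueness lets any transform
    compute it. *)
Lemma B0normE w g : is_fourier w g -> B0norm w = L1norm g.
Proof.
move=> wg; have wh : is_fourier w (fhat w) by apply: xgetPex; exists g.
apply: ae_L1norm (is_fourier_ae_unique wh wg).
  by apply: cintegrable_measurable; case: wh.
by apply: cintegrable_measurable; case: wg.
Qed.

Lemma resolventE f : B0 f ->
  resolvent dom_neg_laplacian neg_laplacian z f = resolvent_candidate (fhat f).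
Proof.
move=> f0; have ff := B0_fhat f0; have [gi _] := ff.
have [Du Eu] := resolvent_candidateP gi.
have fE : (fun x => c^-1 * ift (fhat f) x) = f.
  apply/funext => x; rewrite (ift_is_fourier x f0.1 ff).
  by rewrite mulKf // inversion_constant_neq0.
apply: xget_unique; first by split => //; rewrite Eu fE.
by move=> u [Du' Eu']; apply: (resolvent_injective Du' Du); rewrite Eu' Eu fE.
Qed.

Lemma set_bij_resolvent :
  set_bij dom_neg_laplacian B0 (fun u => z *: u - neg_laplacian u).
Proof.
split.
- move=> u [u0 [v [v0 uv]]]; rewrite (neg_laplacianE v0 uv) opprK.
  exact: B0D (B0Z z u0) v0.
- by move=> u u' /set_mem Du /set_mem Du'; exact: resolvent_injective.
- move=> f /B0P[g gi ->]; have [Du Eu] := resolvent_candidateP gi.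
  by exists (resolvent_candidate g).
Qed.

(** The free scalar [a] serves two ends: a = 1 gives the bounded inverse, and a = z gives the
    uniform bound of sectoriality. On the frequency side the estimate is pointwise, since |symbol|
    >= |z|. *)
Lemma B0norm_resolvent (a : R[i]) f : B0 f ->
  B0norm (a *: resolvent dom_neg_laplacian neg_laplacian z f) <=
  cabs a / cabs z * B0norm f.
Proof.
move=> f0; rewrite resolventE //; have [gi _] := B0_fhat f0.
have si := cintegrable_divs gi.
have asi := cintegrableZ a si.
rewrite (_ : a *: _ = fun x => c^-1 * ift
    (fun xi => a * ((symbol xi)^-1 * fhat f xi)) x); last first.
  by apply/funext => x; rewrite iftZ // mulrCA.
rewrite (B0normE (is_fourier_ift asi)) /B0norm.
rewrite -RintegralZl //; last exact: integrable_cabs.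
apply: le_Rintegral => //.
- exact: integrable_cabs.
- by apply: integrableZl_EFin; exact: integrable_cabs.
- move=> xi _; rewrite !cabsM mulrA ler_wpM2r ?cabs_ge0 // ler_wpM2l ?cabs_ge0
  //.
  rewrite cabsV lef_pV2 ?posrE ?cabs_symbol ?cabs_z_gt0 //.
  by rewrite (lt_le_trans cabs_z_gt0) // cabs_symbol.
Qed.

Lemma op_norm_resolvent (a : R[i]) :
  (op_norm B0 B0norm (fun f => a *: resolvent dom_neg_laplacian neg_laplacian z
    f)
    <= (cabs a / cabs z)%:E)%E.
Proof.
apply: ge_ereal_sup => _ [f [f0 f1] <-]; rewrite lee_fin.
rewrite (le_trans (B0norm_resolvent a f0)) // ler_piMr //.
by rewrite divr_ge0 ?cabs_ge0.
Qed.

End resolvent_formula.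

Theorem corollary3p1 (R : realType) (n : nat) :
  sectorial (@B0 R n) B0norm dom_neg_laplacian neg_laplacian (pi / 2).
Proof.
split.
  move=> z zspec; apply: contrapT => /Re_lt0_notin_closure_sector z0;
    apply: zspec.
  split; first exact: set_bij_resolvent.
  have := @op_norm_resolvent R n z z0 1; under eq_fun do rewrite scale1r.
  by move=> /le_lt_trans; apply; rewrite ltry.
(* With a = z the bound |a|/|z| equals 1 for every z in the left half-plane. *)
apply: (@le_lt_trans _ _ 1%:E); last exact: ltry.
apply: ge_ereal_sup => _ [z /Re_lt0_notin_closure_sector z0 <-].
rewrite (le_trans (op_norm_resolvent z0 z)) // lee_fin divff //.
by rewrite gt_eqF // cabs_z_gt0.
Qed.
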